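(* Let $A$ be an Artin algebra, and let $T^\bullet$ be a tilting complex over $A$ with endomorphism algebra $B={\rm End}_{\mathscr{K}^{\rm b}(A)}(T^\bullet)$. Suppose that $I$ is an ideal in $A$, put $\overline{A}:=A/I$, $\overline{T}^\bullet:=T^\bullet/IT^\bullet$, and let $\overline{B}:=B/J_I$, where $J_I$ is the ideal of $B$ consisting of all endomorphisms of $T^\bullet$ in $\mathscr{K}^{\rm b}(A)$ whose composite with the canonical projection $\pi^\bullet:T^\bullet\to\overline{T}^\bullet$ is zero in $\mathscr{K}^{\rm b}(A)$. Then $\overline{T}^\bullet$ is a tilting complex over $\overline{A}$ and induces a derived equivalence between $\overline{A}$ and $\overline{B}$ if and only if ${\rm Hom}_{\mathscr{K}^{\rm b}(A)}(T^\bullet,IT^\bullet[i])=0$ for all $i\neq0$ and ${\rm Hom}_{\mathscr{K}^{\rm b}(A)}(\overline{T}^\bullet,\overline{T}^\bullet[-1])=0$.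
   Context: $R$ is a fixed commutative Artin ring; Artin algebras are $R$-algebras finitely generated as $R$-modules; modules are finitely generated left modules. $\mathscr{K}^{\rm b}(A)$ is the bounded homotopy category of complexes over $A$-mod, and $\mathscr{K}^{\rm b}(A\text{-proj})$ its full subcategory of bounded complexes of projective modules. A tilting complex over $A$ is a complex $T^\bullet\in\mathscr{K}^{\rm b}(A\text{-proj})$ such that ${\rm Hom}(T^\bullet,T^\bullet[n])=0$ for all $n\neq0$ and $\mathrm{add}(T^\bullet)$ generates $\mathscr{K}^{\rm b}(A\text{-proj})$ as a triangulated category. For a complex $X^\bullet$ of $A$-modules, $IX^\bullet$ is the subcomplex with $i$-th term $IX^i$, and $\overline{X}^\bullet=X^\bullet/IX^\bullet$, a complex of $\overline{A}$-modules, also viewed as a complex of $A$-modules. Each chain map $T^\bullet\to T^\bullet$ induces a chain map $\overline{T}^\bullet\to\overline{T}^\bullet$; this gives an algebra homomorphism $\eta:{\rm End}_{\mathscr{K}^{\rm b}(A)}(T^\bullet)\to{\rm End}_{\mathscr{K}^{\rm b}(A)}(\overline{T}^\bullet)$, and $J_I={\rm Ker}(\eta)$; equivalently $J_I$ consists of the endomorphisms factoring in $\mathscr{K}^{\rm b}(A)$ through the embedding $IT^\bullet\to T^\bullet$. That the tilting complex $\overline{T}^\bullet$ over $\overline{A}$ induces a derived equivalence between $\overline{A}$ and $\overline{B}$ means that $\overline{B}$ is isomorphic, as an $R$-algebra, to ${\rm End}_{\mathscr{K}^{\rm b}(\overline{A})}(\overline{T}^\bullet)$ (so Rickard's theorem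 yields the derived equivalence). *)

(* Defs.v *)
From HB Require Import structures.
From mathcomp Require Import all_boot all_order all_algebra.
From mathcomp Require Import boolp.

Set Implicit Arguments.
Unset Strict Implicit.
Unset Printing Implicit Defensive.

Import GRing.Theory.

Local Open Scope ring_scope.
Local Open Scope quotient_scope.

#[local] Obligation Tactic := idtac.

(* MathComp's algType R excludes the zero ring, but A / I, the endomorphism    *)
(* algebras and their quotients may vanish (for instance when I = A). Hence    *)
(* R-algebras are taken here as rings, possibly zero, together with a ring     *)
(* morphism from R to their centre.                                            *)
HB.mixin Record PzRing_hasAlgMap (R : pzRingType) A of GRing.PzRing A := {
  alg_map : R -> A;
  alg_map_zmod : zmod_morphism alg_map;
  alg_map_monoid : monoid_morphism alg_map;
  alg_map_central : forall (r : R) (x : A), alg_map r * x = x * alg_map r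
}.

#[short(type="pzAlgType")]
HB.structure Definition PzAlgebra (R : pzRingType) :=
  {A of GRing.PzRing A & PzRing_hasAlgMap R A}.

HB.instance Definition _ (R : pzRingType) (A : pzAlgType R) :=
  GRing.isZmodMorphism.Build R A (@alg_map R A) alg_map_zmod.
HB.instance Definition _ (R : pzRingType) (A : pzAlgType R) :=
  GRing.isMonoidMorphism.Build R A (@alg_map R A) alg_map_monoid.

Definition alg_iso (R : pzRingType) (B C : pzAlgType R) : Prop :=
  exists phi : {rmorphism B -> C},
    (forall r : R, phi (alg_map r) = alg_map r) /\ bijective phi.

Section BaseModule.
Variables (R : pzRingType) (A : pzAlgType R).

Definition base_mod : Type := A.
HB.instance Definition _ := GRing.Zmodule.on base_mod.

Definition base_scale (r : R) (x : base_mod) : base_mod := alg_map r * (x : A).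

Fact base_scaleA a b v : base_scale a (base_scale b v) = base_scale (a * b) v.
Proof. by rewrite /base_scale rmorphM mulrA. Qed.
Fact base_scale1 : left_id 1 base_scale.
Proof. by move=> x; rewrite /base_scale rmorph1 mul1r. Qed.
Fact base_scaleDr : right_distributive base_scale +%R.
Proof. by move=> r x y; exact: mulrDr. Qed.
Fact base_scaleDl v : {morph base_scale^~ v : a b / a + b}.
Proof. by move=> a b; rewrite /base_scale rmorphD mulrDl. Qed.
HB.instance Definition _ := GRing.Zmodule_isLmodule.Build R base_mod
  base_scaleA base_scale1 base_scaleDr base_scaleDl.

End BaseModule.

HB.mixin Record isTwoSided (A : pzRingType) (I : A -> bool) := {
  twoSidedMl : forall a x, x \in I -> a * x \in I;
  twoSidedMr : forall a x, x \in I -> x * a \in I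
}.

#[short(type="twoSidedIdeal")]
HB.structure Definition TwoSidedIdeal (A : pzRingType) :=
  {I of GRing.ZmodClosed A I & isTwoSided A I}.

Definition artinian (R : comPzRingType) : Prop :=
  forall I : nat -> twoSidedIdeal R,
    (forall n, {subset I n.+1 <= I n}) ->
    exists n, forall m, (n <= m)%N -> I m =i I n.

Definition fin_gen (A : pzRingType) (M : lmodType A) : Prop :=
  exists (n : nat) (g : 'I_n -> M),
    forall x, exists c : 'I_n -> A, x = \sum_(i < n) c i *: g i.

Definition artin_algebra (R : comPzRingType) (A : pzAlgType R) : Prop :=
  artinian R /\ fin_gen (base_mod A).

Definition projective (A : pzRingType) (P : lmodType A) : Prop :=
  forall (M N : lmodType A) (p : {linear M -> N}) (f : {linear P -> N}),
    (forall y, exists x, p x = y) ->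
    exists g : {linear P -> M}, forall x, p (g x) = f x.

Section QuotientAlgebra.
Variables (R : pzRingType) (A : pzAlgType R) (I : twoSidedIdeal A).

Definition quot_alg : Type := Quotient.quot I.
HB.instance Definition _ := GRing.Zmodule.on quot_alg.
HB.instance Definition _ := EqQuotient.on quot_alg.

Definition alg_proj (a : A) : quot_alg := \pi_quot_alg a.

Definition quot_one : quot_alg := alg_proj 1.
Definition quot_mul (x y : quot_alg) : quot_alg := alg_proj (repr x * repr y).
Definition quot_map (r : R) : quot_alg := alg_proj (alg_map r).

Lemma quot_algE (a b : A) : a - b \in I -> alg_proj a = alg_proj b.
Proof. by move=> ab; apply/eqP; rewrite -Quotient.idealrBE. Qed.

Lemma quot_alg_repr (a : A) : repr (alg_proj a) - a \in I.
Proof. by rewrite Quotient.idealrBE; apply/eqP; exact: reprK. Qed.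

Lemma quot_algD (a b : A) : alg_proj (a + b) = alg_proj a + alg_proj b.
Proof. exact: (raddfD (\pi_(Quotient.quot I))). Qed.

Lemma quot_mulE (a b : A) : quot_mul (alg_proj a) (alg_proj b) = alg_proj (a * b).
Proof.
apply: quot_algE; set a' := repr _; set b' := repr _.
have -> : a' * b' - a * b = (a' - a) * b' + a * (b' - b).
  by rewrite mulrBl mulrBr addrA subrK.
rewrite rpredD //.
- by apply: twoSidedMr; exact: quot_alg_repr.
- by apply: twoSidedMl; exact: quot_alg_repr.
Qed.

Lemma quot_ind (P : quot_alg -> Prop) : (forall a, P (alg_proj a)) -> forall x, P x.
Proof. by move=> H x; rewrite -[x]reprK. Qed.

Fact quot_mulA : associative quot_mul.
Proof. by do 3!elim/quot_ind=> ?; rewrite !quot_mulE mulrA. Qed.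
Fact quot_mul1 : left_id quot_one quot_mul.
Proof. by elim/quot_ind=> ?; rewrite !quot_mulE mul1r. Qed.
Fact quot_mulr1 : right_id quot_one quot_mul.
Proof. by elim/quot_ind=> ?; rewrite !quot_mulE mulr1. Qed.
Fact quot_mulDl : left_distributive quot_mul +%R.
Proof.
by do 3!elim/quot_ind=> ?; rewrite -quot_algD !quot_mulE mulrDl quot_algD.
Qed.
Fact quot_mulDr : right_distributive quot_mul +%R.
Proof.
by do 3!elim/quot_ind=> ?; rewrite -quot_algD !quot_mulE mulrDr quot_algD.
Qed.
HB.instance Definition _ := GRing.Zmodule_isPzRing.Build quot_alg
  quot_mulA quot_mul1 quot_mulr1 quot_mulDl quot_mulDr.

Fact quot_map_zmod : zmod_morphism quot_map.
Proof.
move=> a b; rewrite /quot_map raddfB.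
exact: (raddfB (\pi_(Quotient.quot I))).
Qed.
Fact quot_map_monoid : monoid_morphism quot_map.
Proof.
split; first by rewrite /quot_map rmorph1.
by move=> a b; rewrite /quot_map rmorphM -quot_mulE.
Qed.
Fact quot_map_central r (x : quot_alg) : quot_map r * x = x * quot_map r.
Proof.
elim/quot_ind: x => x.
change (quot_mul (alg_proj (alg_map r)) (alg_proj x) = quot_mul (alg_proj x) (alg_proj (alg_map r))).
by rewrite !quot_mulE alg_map_central.
Qed.
HB.instance Definition _ := PzRing_hasAlgMap.Build R quot_alg
  quot_map_zmod quot_map_monoid quot_map_central.

End QuotientAlgebra.

Section IdealTimesModule.
Variables (R : pzRingType) (A : pzAlgType R) (I : twoSidedIdeal A).
Variable (M : lmodType A).

Definition ideal_mul : {pred M} := fun x =>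
  `[< exists (n : nat) (a : 'I_n -> A) (m : 'I_n -> M),
        (forall i, a i \in I) /\ x = \sum_(i < n) a i *: m i >].

Lemma ideal_mul_mem (a : A) (x : M) : a \in I -> a *: x \in ideal_mul.
Proof.
move=> aI; apply/asboolP; exists 1%N, (fun=> a), (fun=> x); split=> //.
by rewrite big_ord1.
Qed.

Fact ideal_mul_submod_closed : submod_closed ideal_mul.
Proof.
split.
  apply/asboolP; exists 0%N, (fun=> 0), (fun=> 0).
  by rewrite big_ord0; split=> // -[].
move=> c x y /asboolP[n [a [m [aI ->]]]] /asboolP[k [b [p [bI ->]]]].
apply/asboolP; exists (n + k)%N.
exists (fun i => match split i with inl j => c * a j | inr j => b j end).
exists (fun i => match split i with inl j => m j | inr j => p j end).
split=> [i|]; first by case: split => // j; exact: twoSidedMl.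
rewrite big_split_ord scaler_sumr /=; congr (_ + _); apply: eq_bigr => i _.
  case: splitP => [j /= /ord_inj <-|j /= ij]; first by rewrite scalerA.
  by have := ltn_ord i; rewrite ij ltnNge leq_addr.
case: splitP => [j /= ij|j /= /addnI/ord_inj <- //].
by have := ltn_ord j; rewrite -ij ltnNge leq_addr.
Qed.
HB.instance Definition _ :=
  GRing.isSubmodClosed.Build A M ideal_mul
    (GRing.submod_closed_semi ideal_mul_submod_closed).

Record ideal_submod : Type :=
  IdealSubmod {submod_val : M; _ : submod_val \in ideal_mul}.
HB.instance Definition _ := [isSub for submod_val].
HB.instance Definition _ := [Choice of ideal_submod by <:].
HB.instance Definition _ := [SubChoice_isSubLmodule of ideal_submod by <:].

Definition quot_mod : Type := Quotient.quot ideal_mul.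
HB.instance Definition _ := GRing.Zmodule.on quot_mod.
HB.instance Definition _ := EqQuotient.on quot_mod.

Definition qmod_proj (x : M) : quot_mod := \pi_quot_mod x.

Definition qmod_scale (a : A) (x : quot_mod) : quot_mod := qmod_proj (a *: repr x).

Lemma quot_modE (x y : M) : x - y \in ideal_mul -> qmod_proj x = qmod_proj y.
Proof. by move=> xy; apply/eqP; rewrite -Quotient.idealrBE. Qed.

Lemma quot_mod_repr (x : M) : repr (qmod_proj x) - x \in ideal_mul.
Proof. by rewrite Quotient.idealrBE; apply/eqP; exact: reprK. Qed.

Lemma quot_modD (x y : M) : qmod_proj (x + y) = qmod_proj x + qmod_proj y.
Proof. exact: (raddfD (\pi_(Quotient.quot ideal_mul))). Qed.

Lemma qmod_scaleE a (x : M) : qmod_scale a (qmod_proj x) = qmod_proj (a *: x).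
Proof. by apply: quot_modE; rewrite -scalerBr rpredZ // quot_mod_repr. Qed.

Lemma qmod_ind (P : quot_mod -> Prop) : (forall x, P (qmod_proj x)) -> forall x, P x.
Proof. by move=> H x; rewrite -[x]reprK. Qed.

Fact qmod_scaleA a b v : qmod_scale a (qmod_scale b v) = qmod_scale (a * b) v.
Proof. by elim/qmod_ind: v => ?; rewrite !qmod_scaleE scalerA. Qed.
Fact qmod_scale1 : left_id 1 qmod_scale.
Proof. by elim/qmod_ind=> ?; rewrite qmod_scaleE scale1r. Qed.
Fact qmod_scaleDr : right_distributive qmod_scale +%R.
Proof.
move=> r; do 2!elim/qmod_ind=> ?.
by rewrite -quot_modD !qmod_scaleE scalerDr quot_modD.
Qed.
Fact qmod_scaleDl v : {morph qmod_scale^~ v : a b / a + b}.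
Proof.
by elim/qmod_ind: v => ? a b; rewrite !qmod_scaleE scalerDl quot_modD.
Qed.
HB.instance Definition _ := GRing.Zmodule_isLmodule.Build A quot_mod
  qmod_scaleA qmod_scale1 qmod_scaleDr qmod_scaleDl.

Fact qmod_proj_linear : linear qmod_proj.
Proof.
by move=> a x y; rewrite quot_modD -qmod_scaleE.
Qed.
HB.instance Definition _ :=
  GRing.isLinear.Build A M quot_mod _ qmod_proj qmod_proj_linear.

Definition bar_mod : Type := quot_mod.
HB.instance Definition _ := GRing.Zmodule.on bar_mod.
HB.instance Definition _ := EqQuotient.on bar_mod.

Definition bar_scale (a : quot_alg I) (x : bar_mod) : bar_mod :=
  repr a *: (x : quot_mod).

Definition bar_proj (x : M) : bar_mod := qmod_proj x.

Lemma bar_scaleE (a : A) (x : M) :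
  bar_scale (alg_proj I a) (bar_proj x) = bar_proj (a *: x).
Proof.
rewrite /bar_scale /bar_proj.
change (qmod_scale (repr (alg_proj I a)) (qmod_proj x)
        = qmod_proj (a *: x)).
rewrite qmod_scaleE; apply: quot_modE; rewrite -scalerBl.
by apply: ideal_mul_mem; exact: quot_alg_repr.
Qed.

Lemma bar_ind (P : bar_mod -> Prop) :
  (forall x, P (bar_proj x)) -> forall x, P x.
Proof. exact: qmod_ind. Qed.

Lemma bar_modD (x y : M) : bar_proj (x + y) = bar_proj x + bar_proj y.
Proof. exact: quot_modD. Qed.

Fact bar_scaleA a b v : bar_scale a (bar_scale b v) = bar_scale (a * b) v.
Proof.
elim/bar_ind: v => v; elim/quot_ind: a => a; elim/quot_ind: b => b.
have -> : alg_proj I a * alg_proj I b = alg_proj I (a * b) by exact: quot_mulE.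
by rewrite !bar_scaleE scalerA.
Qed.
Fact bar_scale1 : left_id 1 bar_scale.
Proof. by elim/bar_ind=> ?; rewrite bar_scaleE scale1r. Qed.
Fact bar_scaleDr : right_distributive bar_scale +%R.
Proof.
move=> a x y; elim/quot_ind: a => a.
elim/bar_ind: x => x; elim/bar_ind: y => y.
by rewrite -bar_modD !bar_scaleE scalerDr bar_modD.
Qed.
Fact bar_scaleDl v : {morph bar_scale^~ v : a b / a + b}.
Proof.
elim/bar_ind: v => v a b; elim/quot_ind: a => a; elim/quot_ind: b => b.
by rewrite -quot_algD !bar_scaleE scalerDl bar_modD.
Qed.
HB.instance Definition _ := GRing.Zmodule_isLmodule.Build (quot_alg I) bar_mod
  bar_scaleA bar_scale1 bar_scaleDr bar_scaleDl.

End IdealTimesModule.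
Arguments ideal_mul {R A} I M.

(* The differential is indexed by source and target, vanishing unless the      *)
(* target degree is the successor of the source degree; this avoids transport  *)
(* along equalities such as (i + 1) + n = (i + n) + 1.                         *)
Record cochain (A : pzRingType) : Type := Cochain {
  obj :> int -> lmodType A;
  diff : forall i j, {linear obj i -> obj j};
  diff_shape : forall i j x, j != i + 1 -> diff i j x = 0;
  diff_diff : forall i j k x, diff j k (diff i j x) = 0
}.
Arguments diff {A} c i j.

Record chain_map (A : pzRingType) (X Y : cochain A) : Type := ChainMap {
  cmap :> forall i, {linear X i -> Y i};
  cmapP : forall i j x, cmap j (diff X i j x) = diff Y i j (cmap i x)
}.

Section ChainMaps.
Variable (A : pzRingType).
Implicit Types X Y Z : cochain A.

Lemma linear_ext (U V : lmodType A) (f g : {linear U -> V}) : f =1 g -> f = g.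
Proof.
case: f g => f [[f1] [f2]] [g [[g1] [g2]]] /= /funext fg; subst g.
by congr GRing.Linear.Pack; congr GRing.Linear.Class; congr (_ _);
   exact: Prop_irrelevance.
Qed.

Lemma chain_map_ext X Y (f g : chain_map X Y) :
  (forall i x, f i x = g i x) -> f = g.
Proof.
case: f g => f fP [g gP] /= fg.
have E : f = g by apply: functional_extensionality_dep => i;
  apply: linear_ext => x; exact: fg.
by subst g; congr ChainMap; exact: Prop_irrelevance.
Qed.

HB.instance Definition _ X Y := gen_eqMixin (chain_map X Y).
HB.instance Definition _ X Y := gen_choiceMixin (chain_map X Y).

Program Definition cm_zero X Y : chain_map X Y :=
  @ChainMap A X Y (fun i => \0 : {linear X i -> Y i}) _.
Next Obligation. by move=> X Y i j x /=; rewrite linear0. Qed.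

Program Definition cm_add X Y (f g : chain_map X Y) : chain_map X Y :=
  @ChainMap A X Y (fun i => f i \+ g i : {linear X i -> Y i}) _.
Next Obligation. by move=> X Y f g i j x /=; rewrite !cmapP linearD. Qed.

Program Definition cm_opp X Y (f : chain_map X Y) : chain_map X Y :=
  @ChainMap A X Y (fun i => \- f i : {linear X i -> Y i}) _.
Next Obligation. by move=> X Y f i j x /=; rewrite !cmapP linearN. Qed.

Program Definition cm_id X : chain_map X X :=
  @ChainMap A X X (fun i => idfun : {linear X i -> X i}) _.
Next Obligation. by []. Qed.

Program Definition cm_comp X Y Z (g : chain_map Y Z) (f : chain_map X Y) :
    chain_map X Z :=
  @ChainMap A X Z (fun i => g i \o f i : {linear X i -> Z i}) _.
Next Obligation. by move=> X Y Z g f i j x /=; rewrite !cmapP. Qed.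

Fact cm_addA X Y : associative (@cm_add X Y).
Proof. by move=> f g h; apply: chain_map_ext => i x /=; rewrite addrA. Qed.
Fact cm_addC X Y : commutative (@cm_add X Y).
Proof. by move=> f g; apply: chain_map_ext => i x /=; rewrite addrC. Qed.
Fact cm_add0 X Y : left_id (cm_zero X Y) (@cm_add X Y).
Proof. by move=> f; apply: chain_map_ext => i x /=; rewrite add0r. Qed.
Fact cm_addN X Y : left_inverse (cm_zero X Y) (@cm_opp X Y) (@cm_add X Y).
Proof. by move=> f; apply: chain_map_ext => i x /=; rewrite addNr. Qed.
HB.instance Definition _ X Y := GRing.isZmodule.Build (chain_map X Y)
  (@cm_addA X Y) (@cm_addC X Y) (@cm_add0 X Y) (@cm_addN X Y).

(* Only the components h i (i - 1) of a homotopy matter.                       *)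
Definition null_homotopic X Y (f : chain_map X Y) : Prop :=
  exists h : forall i j, {linear X i -> Y j},
    forall i x, f i x = diff Y (i - 1) i (h i (i - 1) x)
                        + h (i + 1) i (diff X i (i + 1) x).

Definition null_htp X Y : {pred chain_map X Y} :=
  fun f => `[< null_homotopic f >].
Arguments null_htp : clear implicits.

Fact null_htp_zmod_closed X Y : zmod_closed (null_htp X Y).
Proof.
split.
  apply/asboolP; exists (fun i j => \0 : {linear X i -> Y j}) => i x /=.
  by rewrite linear0 addr0.
move=> f g /asboolP[h fh] /asboolP[k gk]; apply/asboolP.
exists (fun i j => h i j \+ (\- k i j) : {linear X i -> Y j}) => i x /=.
by rewrite fh gk linearB opprD addrACA.
Qed.
HB.instance Definition _ X Y := GRing.isZmodClosed.Build (chain_map X Y)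
  (null_htp X Y) (null_htp_zmod_closed X Y).

Lemma null_htp_compl X Y Z (g : chain_map Y Z) (f : chain_map X Y) :
  f \in null_htp X Y -> cm_comp g f \in null_htp X Z.
Proof.
move=> /asboolP[h fh]; apply/asboolP.
exists (fun i j => g j \o h i j : {linear X i -> Z j}) => i x /=.
by rewrite fh linearD cmapP.
Qed.

Lemma null_htp_compr X Y Z (g : chain_map Y Z) (f : chain_map X Y) :
  g \in null_htp Y Z -> cm_comp g f \in null_htp X Z.
Proof.
move=> /asboolP[h gh]; apply/asboolP.
exists (fun i j => h i j \o f i : {linear X i -> Z j}) => i x /=.
by rewrite gh cmapP.
Qed.

Definition KHom X Y : Type := Quotient.quot (null_htp X Y).
HB.instance Definition _ X Y := GRing.Zmodule.on (KHom X Y).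
HB.instance Definition _ X Y := EqQuotient.on (KHom X Y).

Definition Kcls X Y (f : chain_map X Y) : KHom X Y := \pi_(KHom X Y) f.

Definition Kcomp X Y Z (g : KHom Y Z) (f : KHom X Y) : KHom X Z :=
  Kcls (cm_comp (repr g) (repr f)).

Lemma Kcls_eq X Y (f g : chain_map X Y) :
  (Kcls f = Kcls g) <-> f - g \in null_htp X Y.
Proof.
by split=> [/eqP|fg]; [rewrite Quotient.idealrBE | apply/eqP;
   rewrite -Quotient.idealrBE].
Qed.

Lemma Kcls_eq0 X Y (f : chain_map X Y) : (Kcls f = 0) <-> null_homotopic f.
Proof.
have -> : 0 = Kcls (0 : chain_map X Y).
  by rewrite /Kcls (raddf0 (\pi_(Quotient.quot (null_htp X Y)))).
by rewrite Kcls_eq subr0; split=> /asboolP.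
Qed.

Lemma KcompE X Y Z (g : chain_map Y Z) (f : chain_map X Y) :
  Kcomp (Kcls g) (Kcls f) = Kcls (cm_comp g f).
Proof.
rewrite /Kcomp; set g' := repr _; set f' := repr _.
have gg : g' - g \in null_htp Y Z by apply/Kcls_eq; exact: reprK.
have ff : f' - f \in null_htp X Y by apply/Kcls_eq; exact: reprK.
apply/Kcls_eq.
have -> : cm_comp g' f' - cm_comp g f
          = cm_comp (g' - g) f' + cm_comp g (f' - f).
  by apply: chain_map_ext => i x /=; rewrite linearB addrA subrK.
by apply: rpredD; [exact: null_htp_compr | exact: null_htp_compl].
Qed.

Definition Kiso X Y : Prop :=
  exists (f : KHom X Y) (g : KHom Y X),
    Kcomp g f = Kcls (cm_id X) /\ Kcomp f g = Kcls (cm_id Y).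

Definition Hom_zero X Y : Prop := forall f : KHom X Y, f = 0.

Section Shift.
Variables (n : int) (X : cochain A).

Definition shift_diff i j (x : X (i + n)) : X (j + n) :=
  if odd `|n|%N then - diff X (i + n) (j + n) x else diff X (i + n) (j + n) x.

Fact shift_diff_linear i j : linear (@shift_diff i j).
Proof.
move=> a x y; rewrite /shift_diff; case: ifP => _; rewrite linearP //.
by rewrite opprD scalerN.
Qed.
HB.instance Definition _ i j :=
  GRing.isLinear.Build A (X (i + n)) (X (j + n)) _ (@shift_diff i j)
    (@shift_diff_linear i j).

Program Definition shift : cochain A :=
  @Cochain A (fun i => X (i + n)) (fun i j => @shift_diff i j) _ _.
Next Obligation.
move=> i j x ij /=; rewrite /shift_diff diff_shape ?oppr0 ?if_same //.
by apply: contraNneq ij => e; apply/eqP/(addIr n); rewrite e addrAC.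
Qed.
Next Obligation.
by move=> i j k x /=; rewrite /shift_diff; case: (odd _);
  rewrite ?linearN diff_diff ?opprK.
Qed.

End Shift.

Section DirectSum.
Variables (X Y : cochain A).

Definition dsum_diff i j (x : X i * Y i) : X j * Y j :=
  (diff X i j x.1, diff Y i j x.2).

Fact dsum_diff_linear i j : linear (@dsum_diff i j).
Proof. by move=> a x y; rewrite /dsum_diff !linearP. Qed.
HB.instance Definition _ i j :=
  GRing.isLinear.Build A (X i * Y i)%type (X j * Y j)%type _ (@dsum_diff i j)
    (@dsum_diff_linear i j).

Program Definition dsum : cochain A :=
  @Cochain A (fun i => (X i * Y i)%type) (fun i j => @dsum_diff i j) _ _.
Next Obligation. by move=> i j x ij; rewrite /= /dsum_diff !diff_shape. Qed.
Next Obligation. by move=> i j k x; rewrite /= /dsum_diff /= !diff_diff. Qed.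

End DirectSum.

Section Copies.
Variables (n : nat) (X : cochain A).

Definition copies_diff i j (x : {ffun 'I_n -> X i}) : {ffun 'I_n -> X j} :=
  [ffun k => diff X i j (x k)].

Fact copies_diff_linear i j : linear (@copies_diff i j).
Proof. by move=> a x y; apply/ffunP=> k; rewrite !ffunE linearP. Qed.
HB.instance Definition _ i j :=
  GRing.isLinear.Build A {ffun 'I_n -> X i} {ffun 'I_n -> X j} _
    (@copies_diff i j) (@copies_diff_linear i j).

Program Definition copies : cochain A :=
  @Cochain A (fun i => {ffun 'I_n -> X i}) (fun i j => @copies_diff i j) _ _.
Next Obligation.
by move=> i j x ij; apply/ffunP=> k; rewrite !ffunE diff_shape.
Qed.
Next Obligation.
by move=> i j k x; apply/ffunP=> l; rewrite !ffunE diff_diff.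
Qed.

End Copies.

(* The identity of X i if i = j, and zero otherwise.                           *)
Definition deg_id (X : cochain A) (i j : int) (x : X i) : X j :=
  if i =P j is ReflectT e then ecast k (X k) e x else 0.

Lemma deg_id_refl (X : cochain A) i (x : X i) : deg_id i x = x.
Proof. by rewrite /deg_id; case: eqP => // e; rewrite eq_axiomK. Qed.

Fact deg_id_linear (X : cochain A) i j : linear (@deg_id X i j).
Proof.
move=> a x y; rewrite /deg_id; case: eqP => [e|_]; first by case: _ / e.
by rewrite scaler0 addr0.
Qed.
HB.instance Definition _ (X : cochain A) i j :=
  GRing.isLinear.Build A (X i) (X j) _ (@deg_id X i j) (@deg_id_linear X i j).

Section Cone.
Variables (X Y : cochain A) (f : chain_map X Y).

Definition cone_diff i j (u : X (i + 1) * Y i) : X (j + 1) * Y j :=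
  (- diff X (i + 1) (j + 1) u.1, deg_id j (f (i + 1) u.1) + diff Y i j u.2).

Fact cone_diff_linear i j : linear (@cone_diff i j).
Proof.
move=> a u v; congr (_, _); rewrite /=.
  by rewrite linearP opprD scalerN.
by rewrite !linearP scalerDr addrACA.
Qed.
HB.instance Definition _ i j :=
  GRing.isLinear.Build A (X (i + 1)%R * Y i)%type (X (j + 1)%R * Y j)%type _
    (@cone_diff i j) (@cone_diff_linear i j).

Program Definition cone : cochain A :=
  @Cochain A (fun i => (X (i + 1)%R * Y i)%type) (fun i j => @cone_diff i j) _ _.
Next Obligation.
move=> i j u ij; rewrite /= /cone_diff !diff_shape //; last first.
  by apply: contraNneq ij => /addIr ->.
rewrite oppr0 addr0 /deg_id; case: eqP => // e.
by rewrite e eqxx in ij.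
Qed.
Next Obligation.
move=> i j k u; rewrite /= /cone_diff /= linearN diff_diff !oppr0.
congr (_, _); rewrite !linearD /= diff_diff addr0 linearN linearN /=.
have [ij|ij] := eqVneq j (i + 1); last first.
  rewrite (diff_shape _ (i := i + 1)) ?linear0; last first.
    by apply: contraNneq ij => /addIr ->.
  rewrite add0r /deg_id; case: eqP => [e|_]; last exact: linear0.
  by rewrite e eqxx in ij.
subst j; rewrite deg_id_refl.
have [jk|jk] := eqVneq k (i + 1 + 1).
  by subst k; rewrite deg_id_refl cmapP addNr.
rewrite [diff Y _ _ _]diff_shape // addr0 /deg_id; case: eqP => [e|_].
  by rewrite e eqxx in jk.
by rewrite oppr0.
Qed.

End Cone.

Definition bounded X : Prop :=
  exists N : nat, forall i : int, (N < `|i|)%N -> forall x : X i, x = 0.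

(* The objects of K^b(A-proj).                                                 *)
Definition perfect X : Prop :=
  bounded X /\ forall i, fin_gen (X i) /\ projective (X i).

(* The objects of add(T), formed in K^b(A-proj).                               *)
Definition in_add (T X : cochain A) : Prop :=
  perfect X /\ exists (n : nat) (Y : cochain A),
    perfect Y /\ Kiso (dsum X Y) (copies n T).

(* P is the class of objects of a strictly full triangulated subcategory of    *)
(* K^b(A-proj).                                                                *)
Record triangulated_subcat (P : cochain A -> Prop) : Prop := {
  tri_perfect : forall X, P X -> perfect X;
  tri_iso : forall X Y, P X -> perfect Y -> Kiso X Y -> P Y;
  tri_shift : forall X n, P X -> P (shift n X);
  tri_cone : forall X Y (f : chain_map X Y), P X -> P Y -> P (cone f)
}.

Definition generates (S : cochain A -> Prop) : Prop :=
  forall P, triangulated_subcat P -> (forall X, S X -> P X) ->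
    forall X, perfect X -> P X.

Definition tilting (T : cochain A) : Prop :=
  [/\ perfect T,
      forall n : int, n != 0 -> Hom_zero T (shift n T) &
      generates (in_add T)].

End ChainMaps.
Arguments null_htp {A} X Y.

Section EndAlgebra.
Variables (R : pzRingType) (A : pzAlgType R) (X : cochain A).

Definition cend : Type := chain_map X X.
HB.instance Definition _ := GRing.Zmodule.on cend.

Fact cend_mulA : associative (@cm_comp A X X X : cend -> cend -> cend).
Proof. by move=> f g h; apply: chain_map_ext. Qed.
Fact cend_mul1 : left_id (cm_id X) (@cm_comp A X X X : cend -> cend -> cend).
Proof. by move=> f; apply: chain_map_ext. Qed.
Fact cend_mulr1 : right_id (cm_id X) (@cm_comp A X X X : cend -> cend -> cend).
Proof. by move=> f; apply: chain_map_ext. Qed.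
Fact cend_mulDl :
  left_distributive (@cm_comp A X X X : cend -> cend -> cend) +%R.
Proof. by move=> f g h; apply: chain_map_ext. Qed.
Fact cend_mulDr :
  right_distributive (@cm_comp A X X X : cend -> cend -> cend) +%R.
Proof. by move=> f g h; apply: chain_map_ext => i x /=; rewrite linearD. Qed.
HB.instance Definition _ := GRing.Zmodule_isPzRing.Build cend
  cend_mulA cend_mul1 cend_mulr1 cend_mulDl cend_mulDr.

Definition base_act (M : lmodType A) (r : R) (x : M) : M :=
  (alg_map r : A) *: x.
Fact base_act_linear (M : lmodType A) r : linear (@base_act M r).
Proof.
by move=> a x y; rewrite /base_act scalerDr !scalerA alg_map_central.
Qed.
HB.instance Definition _ (M : lmodType A) r :=
  GRing.isLinear.Build A M M _ (@base_act M r) (@base_act_linear M r).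

Program Definition cend_map (r : R) : cend :=
  @ChainMap A X X (fun i => @base_act (X i) r) _.
Next Obligation. by move=> r i j x /=; rewrite /base_act linearZ. Qed.

Fact cend_map_zmod : zmod_morphism cend_map.
Proof.
move=> a b; apply: chain_map_ext => i x.
by rewrite /= /base_act raddfB scalerBl.
Qed.
Fact cend_map_monoid : monoid_morphism cend_map.
Proof.
split=> [|a b]; apply: chain_map_ext => i x; rewrite /= /base_act.
  by rewrite rmorph1 scale1r.
by rewrite rmorphM scalerA.
Qed.
Fact cend_map_central r (f : cend) : cend_map r * f = f * cend_map r.
Proof.
by apply: chain_map_ext => i x; rewrite /= /base_act linearZ.
Qed.
HB.instance Definition _ := PzRing_hasAlgMap.Build R cend
  cend_map_zmod cend_map_monoid cend_map_central.

Definition cend_null : {pred cend} := null_htp X X.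
HB.instance Definition _ := GRing.ZmodClosed.on cend_null.
Fact cend_nullMl (a x : cend) : x \in cend_null -> a * x \in cend_null.
Proof. exact: null_htp_compl. Qed.
Fact cend_nullMr (a x : cend) : x \in cend_null -> x * a \in cend_null.
Proof. exact: null_htp_compr. Qed.
HB.instance Definition _ := isTwoSided.Build cend cend_null
  cend_nullMl cend_nullMr.

(* KEnd is KHom X X, with composition (x * y is x after y) as multiplication.  *)
Definition KEnd := quot_alg cend_null.
HB.instance Definition _ := PzAlgebra.on KEnd.

End EndAlgebra.
Arguments cend_null {R A} X.

Section InducedMaps.
Variables (R : pzRingType) (A : pzAlgType R) (I : twoSidedIdeal A).
Variables (M N : lmodType A) (f : {linear M -> N}).

Lemma ideal_mul_map (x : M) : x \in ideal_mul I M -> f x \in ideal_mul I N.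
Proof.
move=> /asboolP[n [a [m [aI ->]]]]; apply/asboolP.
exists n, a, (fun i => f (m i)); split=> //.
by rewrite linear_sum; apply: eq_bigr => i _; rewrite linearZ.
Qed.

Definition sub_map (x : ideal_submod I M) : ideal_submod I N :=
  IdealSubmod (ideal_mul_map (valP x)).
Fact sub_map_linear : linear sub_map.
Proof. by move=> a x y; apply: val_inj; rewrite /= linearP. Qed.
HB.instance Definition _ := GRing.isLinear.Build A
  (ideal_submod I M) (ideal_submod I N) _ sub_map sub_map_linear.

Definition quot_map_mod (x : quot_mod I M) : quot_mod I N :=
  qmod_proj I (f (repr x)).

Lemma quot_map_modE (x : M) :
  quot_map_mod (qmod_proj I x) = qmod_proj I (f x).
Proof.
by apply: quot_modE; rewrite -linearB ideal_mul_map // quot_mod_repr.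
Qed.

Fact quot_map_mod_linear : linear quot_map_mod.
Proof.
move=> a x y; elim/qmod_ind: x => x; elim/qmod_ind: y => y.
by rewrite -linearP !quot_map_modE !linearP.
Qed.
HB.instance Definition _ := GRing.isLinear.Build A
  (quot_mod I M) (quot_mod I N) _ quot_map_mod quot_map_mod_linear.

Definition bar_map (x : bar_mod I M) : bar_mod I N := quot_map_mod x.
Fact bar_map_linear : linear bar_map.
Proof.
move=> a x y; elim/quot_ind: a => a.
elim/bar_ind: x => x; elim/bar_ind: y => y.
have E z : bar_map (bar_proj I z) = bar_proj I (f z) by exact: quot_map_modE.
have S (L : lmodType A) (z : L) :
  alg_proj I a *: bar_proj I z = bar_proj I (a *: z) by exact: bar_scaleE.
by rewrite S -bar_modD !E S -bar_modD linearP.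
Qed.
HB.instance Definition _ := GRing.isLinear.Build (quot_alg I)
  (bar_mod I M) (bar_mod I N) _ bar_map bar_map_linear.

End InducedMaps.

Section IdealComplexes.
Variables (R : pzRingType) (A : pzAlgType R) (I : twoSidedIdeal A).
Variable (X : cochain A).

Program Definition ideal_cx : cochain A :=
  @Cochain A (fun i => ideal_submod I (X i))
    (fun i j => @sub_map R A I (X i) (X j) (diff X i j)) _ _.
Next Obligation. by move=> i j x ij; apply: val_inj; rewrite /= diff_shape. Qed.
Next Obligation. by move=> i j k x; apply: val_inj; rewrite /= diff_diff. Qed.

(* X / I X over A, and below the same complex over A / I.                      *)
Program Definition quot_cx : cochain A :=
  @Cochain A (fun i => quot_mod I (X i))
    (fun i j => @quot_map_mod R A I (X i) (X j) (diff X i j)) _ _.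
Next Obligation.
move=> i j x ij; elim/qmod_ind: x => x.
by rewrite /= quot_map_modE diff_shape // linear0.
Qed.
Next Obligation.
move=> i j k x; elim/qmod_ind: x => x.
by rewrite /= !quot_map_modE diff_diff linear0.
Qed.

Program Definition bar_cx : cochain (quot_alg I) :=
  @Cochain (quot_alg I) (fun i => bar_mod I (X i))
    (fun i j => @bar_map R A I (X i) (X j) (diff X i j)) _ _.
Next Obligation. by move=> i j x ij; exact: (@diff_shape A quot_cx). Qed.
Next Obligation. by move=> i j k x; exact: (@diff_diff A quot_cx). Qed.

Program Definition cx_proj : chain_map X quot_cx :=
  @ChainMap A X quot_cx (fun i => @qmod_proj R A I (X i)) _.
Next Obligation. by move=> i j x; rewrite /= quot_map_modE. Qed.

Definition J_ideal : {pred KEnd X} :=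
  fun b => Kcomp (Kcls cx_proj) (b : KHom X X) == 0.

Lemma J_idealE (f : cend X) :
  (alg_proj (cend_null X) f \in J_ideal)
  = (cm_comp cx_proj f \in null_htp X quot_cx).
Proof.
change ((Kcomp (Kcls cx_proj) (Kcls (f : chain_map X X)) == 0)
        = (cm_comp cx_proj f \in null_htp X quot_cx)).
by rewrite KcompE; apply/eqP/asboolP => /Kcls_eq0.
Qed.

Lemma cend_ideal_null (f : cend X) (g : cend X) :
  cm_comp cx_proj g \in null_htp X quot_cx ->
  cm_comp cx_proj (cm_comp f g) \in null_htp X quot_cx.
Proof.
move=> gn.
pose fb := @ChainMap A quot_cx quot_cx
  (fun i => @quot_map_mod R A I (X i) (X i) (f i)).
have fbP i j x : quot_map_mod (f j) (diff quot_cx i j x)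
               = diff quot_cx i j (quot_map_mod (f i) x).
  by elim/qmod_ind: x => x; rewrite /= !quot_map_modE cmapP.
have -> : cm_comp cx_proj (cm_comp f g) = cm_comp (fb fbP) (cm_comp cx_proj g).
  by apply: chain_map_ext => i x; rewrite /= quot_map_modE.
exact: null_htp_compl.
Qed.

Fact J_ideal_zmod_closed : zmod_closed J_ideal.
Proof.
split.
  rewrite -(raddf0 (\pi_(Quotient.quot (cend_null X)))).
  rewrite (J_idealE 0); have -> : cm_comp cx_proj (0 : cend X) = 0.
    by apply: chain_map_ext => i x; rewrite /= linear0.
  exact: rpred0.
move=> x y; elim/quot_ind: x => f; elim/quot_ind: y => g.
rewrite -(raddfB (\pi_(Quotient.quot (cend_null X)))) (J_idealE (f - g)).
rewrite !J_idealE => fn gn.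
have -> : cm_comp cx_proj (f - g) = cm_comp cx_proj f - cm_comp cx_proj g.
  by apply: chain_map_ext => i x; rewrite /= linearB.
exact: rpredB.
Qed.
HB.instance Definition _ :=
  GRing.isZmodClosed.Build (KEnd X) J_ideal J_ideal_zmod_closed.

Fact J_ideal_Ml (a x : KEnd X) : x \in J_ideal -> a * x \in J_ideal.
Proof.
elim/quot_ind: a => f; elim/quot_ind: x => g.
have -> : alg_proj (cend_null X) f * alg_proj (cend_null X) g
          = alg_proj (cend_null X) (f * g) by exact: quot_mulE.
by rewrite !J_idealE; exact: cend_ideal_null.
Qed.
Fact J_ideal_Mr (a x : KEnd X) : x \in J_ideal -> x * a \in J_ideal.
Proof.
elim/quot_ind: a => f; elim/quot_ind: x => g.
have -> : alg_proj (cend_null X) g * alg_proj (cend_null X) f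
          = alg_proj (cend_null X) (g * f) by exact: quot_mulE.
rewrite !J_idealE => gn.
have -> : cm_comp cx_proj (g * f) = cm_comp (cm_comp cx_proj g) f.
  by apply: chain_map_ext.
exact: null_htp_compr.
Qed.
HB.instance Definition _ := isTwoSided.Build (KEnd X) J_ideal
  J_ideal_Ml J_ideal_Mr.

End IdealComplexes.
Arguments J_ideal {R A} I X.

(* Main.v *)
Require Import Defs.
From HB Require Import structures.
From mathcomp Require Import all_boot all_order all_algebra.
From mathcomp Require Import boolp zify.

(* Since the terms of T are projective, Hom(T, -) turns the exact sequence     *)
(* 0 -> IT -> T -> T/IT -> 0 into a long exact sequence, while chain maps and  *)
(* homotopies from T to T/IT over A are the same thing as those from T/IT to   *)
(* itself over A/I.  With Hom(T, T[i]) = 0 for i <> 0, the vanishing of        *)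
(* Hom(T, IT[i]) for i <> 0 amounts to that of Hom(T/IT, T/IT[i]) for          *)
(* i <> 0, -1 together with the surjectivity of B -> End(T/IT).  The kernel of *)
(* this map is J_I; conversely, an abstract isomorphism of B/J_I with          *)
(* End(T/IT) forces surjectivity, because an injective endomorphism of an      *)
(* Artinian R-module is onto.  That add(T/IT) generates follows by pulling     *)
(* triangulated subcategories back along X |-> X/IX and truncating brutally,   *)
(* once finitely generated projective A/I-modules are lifted to A; this is     *)
(* lifting of idempotents, obtained from Fitting's lemma.                      *)

Set Implicit Arguments.
Unset Strict Implicit.
Unset Printing Implicit Defensive.

Import GRing.Theory.
Local Open Scope ring_scope.
Local Open Scope quotient_scope.

#[local] Obligation Tactic := idtac.

(** * Linear maps, free modules and images of idempotents *)

(** Write Tb for T/IT, regarded over A/I or over A. An A-linear map into an A/I-module kills every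
    multiple by I, so chain maps and null homotopies from T to Tb[n] over A are the same as those
    from Tb to Tb[n] over A/I ([transfer_null], [Hom_zero_bar_shift]). Vanishing can therefore be
    read off from the Hom(T, -) sequence of 0 -> IT -> T -> Tb -> 0, which is available because the
    terms of T are projective. Three fragments of it suffice: [lift_chain_map], [Hom_zero_quotient]
    and [Hom_zero_sub].

    The natural map from B/J_I to End(Tb) is always an injective algebra morphism ([natural_map]);
    what matters is whether it is onto. If Hom(T, IT[i]) = 0 for i <> 0, the case i = 1 lifts every
    endomorphism of Tb to T, and the vanishing of Hom(T, T[n]) and Hom(T, IT[n+1]) gives Hom(Tb,
    Tb[n]) = 0 for n <> 0, -1; degree -1 is the second condition. Conversely, Hom(T, IT[i]) sits
    between Hom(T, Tb[i-1]) and Hom(T, T[i]), which both vanish for i <> 0, 1; for i = 1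
    surjectivity of the natural map is required. The given isomorphism may differ from the natural
    map, but its inverse followed by the natural map is an injective R-linear endomorphism of
    End(Tb). The latter satisfies the descending chain condition over R ([KEnd_dcc]), so this
    endomorphism is onto ([dcc_inj_surj]), and hence so is the natural map.

    Generation passes from T to Tb ([bar_generates]). Perfect complexes over A whose reduction lies
    in a given triangulated subcategory form a triangulated subcategory ([triangulated_pullback]),
    so it is enough that the reductions generate. Brutal truncation leaves only complexes
    concentrated in one degree ([generated_by_stalks]), and these are reductions because finitely
    generated projective A/I-modules are ([lift_projective]): the idempotent cutting such a module
    out of a free module lifts to an endomorphism over A, which Fitting's lemma replaces by an
    idempotent with the same reduction. *)

Definition mk_lin (A : pzRingType) (U V : lmodType A) (f : U -> V)
  (fl : linear f) : {linear U -> V} :=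
  HB.pack f (GRing.isLinear.Build A U V _ f fl).

Section LinearPairs.
Variables (A : pzRingType) (U V : lmodType A).

Fact pair_inl_linear : linear (fun u : U => (u, 0 : V)).
Proof. by move=> a x y; congr (_, _); rewrite /= scaler0 addr0. Qed.
Definition pair_inl := mk_lin pair_inl_linear.
Fact pair_inr_linear : linear (fun v : V => (0 : U, v)).
Proof. by move=> a x y; congr (_, _); rewrite /= scaler0 addr0. Qed.
Definition pair_inr := mk_lin pair_inr_linear.
Fact pair_fst_linear : linear (@fst U V).
Proof. by []. Qed.
Definition pair_fst := mk_lin pair_fst_linear.
Fact pair_snd_linear : linear (@snd U V).
Proof. by []. Qed.
Definition pair_snd := mk_lin pair_snd_linear.

End LinearPairs.

Section LinearFfun.
Variables (A : pzRingType) (n : nat) (U V : lmodType A).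

Fact ffun_eval_linear (k : 'I_n) : linear (fun u : {ffun 'I_n -> U} => u k).
Proof. by move=> a x y; rewrite !ffunE. Qed.
Definition ffun_eval k := mk_lin (ffun_eval_linear k).
Fact ffun_inj_linear (k : 'I_n) :
  linear (fun u : U => [ffun l => if l == k then u else 0] : {ffun 'I_n -> U}).
Proof.
move=> a x y; apply/ffunP=> l; rewrite !ffunE; case: ifP => // _.
by rewrite scaler0 addr0.
Qed.
Definition ffun_inj k := mk_lin (ffun_inj_linear k).

Lemma ffun_inj_sum (u : {ffun 'I_n -> U}) : u = \sum_k ffun_inj k (u k).
Proof.
apply/ffunP=> l; rewrite sum_ffunE (bigD1 l) //= ffunE eqxx big1 ?addr0 //.
by move=> k /negPf kl; rewrite ffunE eq_sym kl.
Qed.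

Fact ffun_gen_linear (g : 'I_n -> V) :
  linear (fun c : {ffun 'I_n -> A^o} => \sum_k (c k : A) *: g k).
Proof.
move=> a x y; rewrite scaler_sumr -big_split; apply: eq_bigr => k _ /=.
by rewrite !ffunE scalerDl scalerA.
Qed.
Definition ffun_gen g := mk_lin (ffun_gen_linear g).

End LinearFfun.

Lemma fin_gen_surj (A : pzRingType) (M N : lmodType A) (p : {linear M -> N}) :
  (forall y, exists x, p x = y) -> fin_gen M -> fin_gen N.
Proof.
move=> ps [n [g gP]]; exists n, (fun i => p (g i)) => y.
have [x <-] := ps y; have [c ->] := gP x; exists c.
by rewrite linear_sum; apply: eq_bigr => i _; rewrite linearZ.
Qed.

Lemma projective_retract (A : pzRingType) (P Q : lmodType A)
    (r : {linear P -> Q}) (s : {linear Q -> P}) :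
  (forall x, r (s x) = x) -> projective P -> projective Q.
Proof.
move=> rs PP M N p f ps; have [g gP] := PP M N p (f \o r) ps.
by exists (g \o s) => x; rewrite /= gP /= rs.
Qed.

Lemma free_projective (A : pzRingType) n : projective {ffun 'I_n -> A^o}.
Proof.
move=> M N p f ps.
have [y yP] := choice (fun k => ps (f (ffun_inj _ k (1 : A^o)))).
exists (ffun_gen y) => x; rewrite /= linear_sum.
rewrite [in RHS](ffun_inj_sum x) linear_sum; apply: eq_bigr => k _.
rewrite linearZ yP -linearZ; congr (f _).
rewrite -linearZ; congr (ffun_inj _ k _).
by rewrite /GRing.scale /= mulr1.
Qed.

Lemma free_fin_gen (A : pzRingType) n : fin_gen {ffun 'I_n -> A^o}.
Proof.
exists n, (fun k => ffun_inj A^o k (1 : A^o)) => x; exists (fun k => x k : A).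
rewrite [LHS](ffun_inj_sum x); apply: eq_bigr => k _.
rewrite -linearZ; congr (ffun_inj _ k _).
by rewrite /GRing.scale /= mulr1.
Qed.

(* The image of an idempotent endomorphism, realised as its fixed points.      *)
Section FixedPoints.
Variables (A : pzRingType) (M : lmodType A) (e : {linear M -> M}).

Definition fix_pred : {pred M} := fun x => e x == x.
Fact fix_pred_closed : submod_closed fix_pred.
Proof.
split=> [|a x y]; first by rewrite -topredE /= /fix_pred linear0.
by rewrite -!topredE /= /fix_pred linearP => /eqP-> /eqP->.
Qed.
HB.instance Definition _ := GRing.isSubmodClosed.Build A M fix_pred
  (GRing.submod_closed_semi fix_pred_closed).
Record fixmod : Type := FixMod {fix_sub : M; _ : fix_sub \in fix_pred}.
HB.instance Definition _ := [isSub for fix_sub].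
HB.instance Definition _ := [Choice of fixmod by <:].
HB.instance Definition _ := [SubChoice_isSubLmodule of fixmod by <:].

Fact fix_sub_linear : linear fix_sub.
Proof. by []. Qed.
Definition fix_val : {linear fixmod -> M} := mk_lin fix_sub_linear.

Lemma fix_val_inj : injective fix_val.
Proof. exact: val_inj. Qed.

Lemma fix_valP x : e (fix_val x) = fix_val x.
Proof. by case: x => x /= /eqP. Qed.

Hypothesis ee : forall x, e (e x) = e x.

Fact fix_in_subproof x : e x \in fix_pred.
Proof. by rewrite -topredE /= /fix_pred ee. Qed.
Fact fix_in_linear : linear (fun x => FixMod (fix_in_subproof x)).
Proof. by move=> a x y; apply: val_inj; rewrite /= linearP. Qed.
Definition fix_in : {linear M -> fixmod} := mk_lin fix_in_linear.

Lemma fix_inK x : fix_in (fix_val x) = x.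
Proof. by apply: fix_val_inj; rewrite /= fix_valP. Qed.

Lemma fix_valK x : fix_val (fix_in x) = e x.
Proof. by []. Qed.

Lemma fixmod_fin_gen : fin_gen M -> fin_gen fixmod.
Proof.
by apply: (fin_gen_surj (p := fix_in)) => y; exists (fix_val y); exact: fix_inK.
Qed.

Lemma fixmod_projective : projective M -> projective fixmod.
Proof. exact: (projective_retract fix_inK). Qed.

End FixedPoints.

(** * Restriction of scalars, and the projection onto A/I *)

Definition res_mod (S A : pzRingType) (s : {rmorphism S -> A})
  (M : lmodType A) : Type := M.

Section Restriction.
Variables (S A : pzRingType) (s : {rmorphism S -> A}) (M : lmodType A).
Local Notation res_mod := (res_mod s M).

HB.instance Definition _ := GRing.Zmodule.on res_mod.
Definition res_scale (r : S) (x : res_mod) : res_mod := s r *: (x : M).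
Fact res_scaleA a b v : res_scale a (res_scale b v) = res_scale (a * b) v.
Proof. by rewrite /res_scale rmorphM scalerA. Qed.
Fact res_scale1 : left_id 1 res_scale.
Proof. by move=> x; rewrite /res_scale rmorph1 scale1r. Qed.
Fact res_scaleDr : right_distributive res_scale +%R.
Proof. by move=> r x y; exact: scalerDr. Qed.
Fact res_scaleDl v : {morph res_scale^~ v : a b / a + b}.
Proof. by move=> a b; rewrite /res_scale rmorphD scalerDl. Qed.
HB.instance Definition _ := GRing.Zmodule_isLmodule.Build S res_mod
  res_scaleA res_scale1 res_scaleDr res_scaleDl.

End Restriction.

Lemma res_linear (S A : pzRingType) (s : {rmorphism S -> A}) (M N : lmodType A)
  (f : {linear M -> N}) : linear (f : res_mod s M -> res_mod s N).
Proof. by move=> a x y; exact: linearP. Qed.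
Definition res_lin (S A : pzRingType) (s : {rmorphism S -> A})
  (M N : lmodType A) (f : {linear M -> N}) := mk_lin (res_linear (s := s) f).

Section QuotientRing.
Variables (R : pzRingType) (A : pzAlgType R) (I : twoSidedIdeal A).

Fact alg_proj_zmod : zmod_morphism (alg_proj I : A -> quot_alg I).
Proof. by move=> a b; exact: (raddfB (\pi_(Quotient.quot I))). Qed.
Fact alg_proj_monoid : monoid_morphism (alg_proj I : A -> quot_alg I).
Proof. by split=> // a b; rewrite -quot_mulE. Qed.
HB.instance Definition _ := GRing.isZmodMorphism.Build A (quot_alg I)
  (@alg_proj R A I) alg_proj_zmod.
HB.instance Definition _ := GRing.isMonoidMorphism.Build A (quot_alg I)
  (@alg_proj R A I) alg_proj_monoid.
Definition alg_projm : {rmorphism A -> quot_alg I} := @alg_proj R A I.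

Lemma alg_proj_eq0 (a : A) : (alg_proj I a = 0) <-> a \in I.
Proof.
rewrite -(rmorph0 alg_projm) -{2}(subr0 a) Quotient.idealrBE.
by split=> /eqP.
Qed.

Lemma alg_proj_surj (x : quot_alg I) : exists a, alg_proj I a = x.
Proof. by exists (repr x); exact: reprK. Qed.

End QuotientRing.

(** * Modules over A / I *)

Section BarModules.
Variables (R : pzRingType) (A : pzAlgType R) (I : twoSidedIdeal A).
Local Notation Abar := (quot_alg I).
Local Notation res := (res_mod (alg_projm I)).

Lemma res_barE (N : lmodType Abar) (a : A) (x : res N) :
  a *: x = alg_proj I a *: (x : N).
Proof. by []. Qed.

Fact bar_proj_linear (M : lmodType A) :
  linear (bar_proj I (M := M) : M -> res (bar_mod I M)).
Proof.
move=> a x y; rewrite res_barE bar_modD; congr (_ + _).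
by rewrite -[RHS]/(bar_scale _ _) bar_scaleE.
Qed.
Definition bar_projl (M : lmodType A) : {linear M -> res (bar_mod I M)} :=
  mk_lin (@bar_proj_linear M).

Fact quot_bar_linear (M : lmodType A) :
  linear (id : quot_mod I M -> res (bar_mod I M)).
Proof.
move=> a x y; rewrite res_barE; congr (_ + _).
elim/qmod_ind: x => x; rewrite -[LHS]/(qmod_scale _ _) qmod_scaleE.
by rewrite -[RHS]/(bar_scale _ _) -[qmod_proj I x]/(bar_proj I x) bar_scaleE.
Qed.
Definition quot_barl (M : lmodType A) : {linear quot_mod I M -> res (bar_mod I M)} :=
  mk_lin (@quot_bar_linear M).

Lemma qmod_proj_eq0 (M : lmodType A) (x : M) :
  (qmod_proj I x = 0) <-> x \in ideal_mul I M.
Proof.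
rewrite -(linear0 (@qmod_proj R A I M)) -{2}(subr0 x) Quotient.idealrBE.
by split=> /eqP.
Qed.

Lemma res_ideal_mul0 (M : lmodType A) (N : lmodType Abar)
    (p : {linear M -> res N}) x :
  x \in ideal_mul I M -> p x = 0.
Proof.
move=> /asboolP[n [a [m [aI ->]]]]; rewrite linear_sum big1 // => i _.
rewrite linearZZ res_barE; have /alg_proj_eq0 -> := aI i.
by rewrite scale0r.
Qed.

Section Transfer.
Variables (X W : lmodType A) (Xb Z : lmodType Abar).
Variables (p : {linear X -> res Xb}) (phi : {linear W -> res Z}).
Hypothesis ps : forall y, exists x, p x = y.
Hypothesis pk : forall x, p x = 0 -> x \in ideal_mul I X.

(** The kernel of [p] lies in I X, which [phi \o f] kills because its target is an A/I-module. [p]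
    stays abstract: it is used both for X -> X/IX and for the passage between X/IX over A and over
    A/I. *)
Lemma transfer_up (f : {linear X -> W}) :
  exists fb : {linear Xb -> Z}, forall x, fb (p x) = phi (f x).
Proof.
have [s sP] := choice ps.
have E x : phi (f (s (p x))) = phi (f x).
  apply/eqP; rewrite -subr_eq0 -!linearB; apply/eqP.
  apply: res_ideal_mul0; apply: ideal_mul_map; apply: pk.
  by rewrite linearB sP subrr.
have fl : linear ((fun y => phi (f (s y))) : Xb -> Z).
  move=> a x y; have [a' <-] := alg_proj_surj a.
  have [x' <-] := ps x; have [y' <-] := ps y.
  have -> : alg_proj I a' *: (p x' : Xb) + (p y' : Xb) = p (a' *: x' + y').
    by rewrite linearP.
  by rewrite !E !linearP.
by exists (mk_lin fl) => x; exact: E.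
Qed.

Lemma transfer_down (fb : {linear Xb -> Z}) :
  bijective phi -> exists f : {linear X -> W}, forall x, phi (f x) = fb (p x).
Proof.
case=> psi phiK psiK.
have fl : linear (fun x => psi (fb (p x))).
  move=> a x y; apply: (can_inj phiK); rewrite [in RHS]linearPZ !psiK res_barE.
  by rewrite !linearPZ.
by exists (mk_lin fl) => x; exact: psiK.
Qed.

End Transfer.

Lemma bar_projl_surj (M : lmodType A) y : exists x, bar_projl M x = y.
Proof. by elim/bar_ind: y => x; exists x. Qed.

Lemma bar_projl_ker (M : lmodType A) x :
  bar_projl M x = 0 -> x \in ideal_mul I M.
Proof. by move/qmod_proj_eq0. Qed.

Lemma bar_fin_gen (M : lmodType A) : fin_gen M -> fin_gen (bar_mod I M).
Proof.
move=> [n [g gP]]; exists n, (fun i => bar_proj I (g i)).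
elim/bar_ind=> x; have [c ->] := gP x; exists (fun i => alg_proj I (c i)).
rewrite -[LHS]/(bar_projl M _) linear_sum.
by apply: eq_bigr => i _; rewrite linearZ.
Qed.

Lemma bar_projective (P : lmodType A) :
  projective P -> projective (bar_mod I P).
Proof.
move=> PP M N p f ps.
have fl : linear ((fun x => f (bar_proj I x)) : P -> res N).
  by move=> a x y; rewrite -[bar_proj I _]/(bar_projl P _) linearPZ res_barE linearPZ.
have [g gP] := PP (res M) (res N) (res_lin (alg_projm I) p) (mk_lin fl) ps.
have idl : linear (id : res M -> res M) by [].
have [gb gbP] :=
  transfer_up (mk_lin idl) (@bar_projl_surj P) (@bar_projl_ker P) g.
exists gb => y; have [x <-] := bar_projl_surj y.
by rewrite gbP; exact: gP.
Qed.

Lemma bar_mapE (M N : lmodType A) (f : {linear M -> N}) x :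
  bar_map f (bar_proj I x) = bar_proj I (f x).
Proof. exact: quot_map_modE. Qed.

Section BarSums.
Variables (U V : lmodType A).

Fact bar_pair_linear : linear (fun u : bar_mod I (U * V)%type =>
  (bar_map (pair_fst U V) u, bar_map (pair_snd U V) u)).
Proof. by move=> a x y; congr (_, _); rewrite /= linearP. Qed.
Definition bar_pair := mk_lin bar_pair_linear.

Lemma bar_pairE x y : bar_pair (bar_proj I (x, y)) = (bar_proj I x, bar_proj I y).
Proof. by rewrite /= !bar_mapE. Qed.

Lemma bar_pair_bij : bijective bar_pair.
Proof.
exists (fun w => bar_map (pair_inl U V) w.1 + bar_map (pair_inr U V) w.2).
  elim/bar_ind=> -[x y]; rewrite bar_pairE !bar_mapE -bar_modD; congr bar_proj.
  by congr (_, _); rewrite /= ?addr0 ?add0r.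
case=> x y; elim/bar_ind: x => x; elim/bar_ind: y => y.
rewrite !bar_mapE -bar_modD -bar_pairE; congr (bar_pair (bar_proj I _)).
by congr (_, _); rewrite /= ?addr0 ?add0r.
Qed.

Variable n : nat.
Fact bar_ffun_linear : linear (fun u : bar_mod I {ffun 'I_n -> U} =>
  [ffun k => bar_map (ffun_eval U k) u] : {ffun 'I_n -> bar_mod I U}).
Proof. by move=> a x y; apply/ffunP=> k; rewrite !ffunE linearP. Qed.
Definition bar_ffun := mk_lin bar_ffun_linear.

Lemma bar_ffunE x k : bar_ffun (bar_proj I x) k = bar_proj I (x k).
Proof. by rewrite ffunE bar_mapE. Qed.

Lemma bar_ffun_bij : bijective bar_ffun.
Proof.
exists (fun w : {ffun 'I_n -> bar_mod I U} =>
  \sum_k bar_map (ffun_inj U k) (w k)) => [|w].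
  elim/bar_ind=> x; rewrite {2}(ffun_inj_sum x).
  rewrite -[RHS]/(bar_projl _ _) linear_sum; apply: eq_bigr => k _.
  by rewrite bar_ffunE bar_mapE.
have [x xP] := choice (fun k => bar_projl_surj (w k)).
have -> : w = bar_ffun (bar_proj I [ffun k => x k]).
  by apply/ffunP=> k; rewrite bar_ffunE ffunE -xP.
congr (bar_ffun _); set u := [ffun k => x k].
rewrite {2}(ffun_inj_sum u).
rewrite -[RHS]/(bar_projl _ _) linear_sum; apply: eq_bigr => k _.
by rewrite bar_ffunE bar_mapE.
Qed.

End BarSums.

End BarModules.

(** * Homotopies and transport between degrees *)

(** Choice in dependent form, because the type of a component of a chain map or homotopy varies with
    the degree. *)
Lemma dep_choice (T : Type) (U : T -> Type) (P : forall t, U t -> Prop) :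
  (forall t, exists u, P t u) -> exists f : forall t, U t, forall t, P t (f t).
Proof.
move=> H; exists (fun t => projT1 (cid (H t))) => t.
exact: projT2 (cid (H t)).
Qed.

Section Homotopy.
Variable A : pzRingType.
Implicit Types X Y Z W : cochain A.

Lemma null_htpP X Y (f : chain_map X Y) :
  reflect (null_homotopic f) (f \in null_htp X Y).
Proof. exact: asboolP. Qed.

Lemma null_homotopicB X Y (f g : chain_map X Y) :
  null_homotopic f -> null_homotopic g -> null_homotopic (f - g).
Proof. by move=> /null_htpP fn /null_htpP gn; apply/null_htpP; exact: rpredB. Qed.

Lemma null_homotopicD X Y (f g : chain_map X Y) :
  null_homotopic f -> null_homotopic g -> null_homotopic (f + g).
Proof. by move=> /null_htpP fn /null_htpP gn; apply/null_htpP; exact: rpredD. Qed.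

Lemma null_homotopic0 X Y : null_homotopic (0 : chain_map X Y).
Proof. by apply/null_htpP; exact: rpred0. Qed.

Lemma null_homotopic_compl X Y Z (g : chain_map Y Z) (f : chain_map X Y) :
  null_homotopic f -> null_homotopic (cm_comp g f).
Proof. by move=> /null_htpP fn; apply/null_htpP; exact: null_htp_compl. Qed.

Lemma null_homotopic_compr X Y Z (g : chain_map Y Z) (f : chain_map X Y) :
  null_homotopic g -> null_homotopic (cm_comp g f).
Proof. by move=> /null_htpP fn; apply/null_htpP; exact: null_htp_compr. Qed.

Lemma Hom_zeroP X Y :
  Hom_zero X Y <-> forall f : chain_map X Y, null_homotopic f.
Proof.
split=> H f; first by apply/Kcls_eq0; exact: H.
by rewrite -[f]reprK; apply/Kcls_eq0; exact: H.
Qed.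

Lemma KisoP X Y : Kiso X Y <->
  exists (f : chain_map X Y) (g : chain_map Y X),
    null_homotopic (cm_comp g f - cm_id X) /\
    null_homotopic (cm_comp f g - cm_id Y).
Proof.
split=> [[f [g [gf fg]]]|[f [g [gf fg]]]].
  exists (repr f), (repr g).
  by split; apply/null_htpP/Kcls_eq.
exists (Kcls f), (Kcls g).
by split; rewrite KcompE; apply/Kcls_eq/null_htpP.
Qed.

Lemma chain_map_inv X Y (f : chain_map X Y) :
  (forall i, bijective (f i)) ->
  exists g : chain_map Y X,
    (forall i x, g i (f i x) = x) /\ (forall i y, f i (g i y) = y).
Proof.
move=> fb.
have [g gP] : exists g : forall i, Y i -> X i,
    forall i, cancel (f i) (g i) /\ cancel (g i) (f i).
  apply: (dep_choice (P := fun i g => cancel (f i) g /\ cancel g (f i))) => i.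
  by have [g fK gK] := fb i; exists g.
have gl i : linear (g i) := can2_linear (gP i).1 (gP i).2.
have gc i j x :
    mk_lin (gl j) (diff Y i j x) = diff X i j (mk_lin (gl i) x).
  by rewrite /= -{1}[x](gP i).2 -cmapP (gP j).1.
exists (ChainMap gc).
by split=> i x; [exact: (gP i).1 | exact: (gP i).2].
Qed.

Lemma Kiso_bij X Y (f : chain_map X Y) : (forall i, bijective (f i)) -> Kiso X Y.
Proof.
move=> /chain_map_inv[g [gf fg]]; apply/KisoP; exists f, g.
have -> : cm_comp g f = cm_id X by apply: chain_map_ext => i x /=; rewrite gf.
have -> : cm_comp f g = cm_id Y by apply: chain_map_ext => i x /=; rewrite fg.
by rewrite !subrr; split; exact: null_homotopic0.
Qed.

Lemma Kiso_sym X Y : Kiso X Y -> Kiso Y X.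
Proof. by move=> [f [g [gf fg]]]; exists g, f. Qed.

Lemma Kiso_trans X Y Z : Kiso X Y -> Kiso Y Z -> Kiso X Z.
Proof.
move=> /KisoP[f [g [gf fg]]] /KisoP[f' [g' [gf' fg']]].
apply/KisoP; exists (cm_comp f' f), (cm_comp g g'); split.
  have -> : cm_comp (cm_comp g g') (cm_comp f' f) - cm_id X =
      cm_comp g (cm_comp (cm_comp g' f' - cm_id Y) f) + (cm_comp g f - cm_id X).
    by apply: chain_map_ext => i x; rewrite /= linearB addrA subrK.
  apply: null_homotopicD => //; apply: null_homotopic_compl.
  exact: null_homotopic_compr.
have -> : cm_comp (cm_comp f' f) (cm_comp g g') - cm_id Z =
    cm_comp f' (cm_comp (cm_comp f g - cm_id Y) g') + (cm_comp f' g' - cm_id Z).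
  by apply: chain_map_ext => i x; rewrite /= linearB addrA subrK.
apply: null_homotopicD => //; apply: null_homotopic_compl.
exact: null_homotopic_compr.
Qed.

Lemma Hom_zero_bij X Y Z (f : chain_map Y Z) :
  (forall i, bijective (f i)) -> Hom_zero X Y <-> Hom_zero X Z.
Proof.
move=> /chain_map_inv[g [gf fg]].
split=> /Hom_zeroP H; apply/Hom_zeroP=> h.
  have -> : h = cm_comp f (cm_comp g h) by apply: chain_map_ext => i x /=; rewrite fg.
  exact/null_homotopic_compl/H.
have -> : h = cm_comp g (cm_comp f h) by apply: chain_map_ext => i x /=; rewrite gf.
exact/null_homotopic_compl/H.
Qed.

Lemma deg_id_diffl X i j k (x : X i) : i = j ->
  diff X j k (deg_id j x) = diff X i k x.
Proof. by move=> ij; subst j; rewrite deg_id_refl. Qed.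

Lemma deg_id_diffr X i j k (x : X i) : j = k ->
  deg_id k (diff X i j x) = diff X i k x.
Proof. by move=> jk; subst k; rewrite deg_id_refl. Qed.

Lemma deg_id_neq X i j (x : X i) : i != j -> deg_id j x = 0.
Proof. by rewrite /deg_id; case: eqP. Qed.

Lemma deg_id_trans X i j k (x : X i) : i = j ->
  deg_id k (deg_id j x) = deg_id k x.
Proof. by move=> ij; subst j; rewrite deg_id_refl. Qed.

Lemma deg_idK X i j : i = j -> cancel (@deg_id A X i j) (@deg_id A X j i).
Proof. by move=> ij x; rewrite deg_id_trans // deg_id_refl. Qed.

Lemma deg_id_bij X i j : i = j -> bijective (@deg_id A X i j).
Proof. by move=> ij; exists (@deg_id A X j i); exact: deg_idK. Qed.

Lemma odd_absz_addz1 (n : int) : odd `|(n + 1)%R|%N = ~~ odd `|n|%N.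
Proof.
case: n => n; first by rewrite -PoszD addn1.
by rewrite NegzE abszN absz_nat -addn1 PoszD opprD addrNK abszN absz_nat addn1 /= negbK.
Qed.

(** The two terms in degree i agree only along the equality i + 1 + n = i + (n + 1), so the map is a
    transport; the signs multiply correctly. This lets results stated for a shift by one serve in
    every degree. *)
Lemma shift_shift_bij X n :
  exists f : chain_map (shift 1 (shift n X)) (shift (n + 1) X),
    forall i, bijective (f i).
Proof.
have e i : i + 1 + n = i + (n + 1) by rewrite -addrA (addrC 1).
pose f i : {linear shift 1 (shift n X) i -> shift (n + 1) X i} :=
  mk_lin (@deg_id_linear A X (i + 1 + n) (i + (n + 1))).
have fP i j x : f j (diff (shift 1 (shift n X)) i j x) =
                diff (shift (n + 1) X) i j (f i x).
  have E k (y : X (k + 1 + n)) : f k y = deg_id (k + (n + 1)) y by [].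
  have D : diff X (i + (n + 1)) (j + (n + 1)) (f i x) =
           f j (diff X (i + 1 + n) (j + 1 + n) x).
    by rewrite !E deg_id_diffr // deg_id_diffl.
  rewrite -[RHS]/(shift_diff _ _) -[diff (shift 1 (shift n X)) i j x]/(- shift_diff _ _).
  rewrite linearN /shift_diff odd_absz_addz1 D.
  by case: (odd _); rewrite // linearN opprK.
exists (ChainMap fP) => i; exact: (@deg_id_bij X (i + 1 + n) _ (e i)).
Qed.

Lemma Hom_zero_shift1 X Y n :
  Hom_zero X (shift 1 (shift n Y)) <-> Hom_zero X (shift (n + 1) Y).
Proof. by have [f /Hom_zero_bij] := shift_shift_bij Y n; exact. Qed.

End Homotopy.

(** * Lifting along short exact sequences *)

Section HomotopyMaps.
Variables (A : pzRingType) (X Y : cochain A).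

Lemma htp_diff (h : forall i j, {linear X i -> Y j}) i j k l (x : X i) :
  j = k -> diff Y j l (h i j x) = diff Y k l (h i k x).
Proof. by move=> ->. Qed.

(** The boundary dh + hd of an arbitrary family h, used to move a chain map inside its homotopy
    class. *)
Program Definition htp_map (h : forall i j, {linear X i -> Y j}) : chain_map X Y :=
  @ChainMap A X Y (fun i => (diff Y (i - 1) i \o h i (i - 1)) \+
                            (h (i + 1) i \o diff X i (i + 1))) _.
Next Obligation.
move=> h i j x; rewrite linearD /= diff_diff add0r diff_diff linear0 addr0.
have [ij|ij] := eqVneq j (i + 1); last by rewrite !(diff_shape _ ij) !linear0.
by subst j; apply: htp_diff; rewrite addrK.
Qed.

(** A homotopy into Y[1] preserves degrees when read in Y; the minus sign comes from the
    differential of [shift 1 Y]. *)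
Lemma null_homotopic_shift1 (f : chain_map X (shift 1 Y)) :
  null_homotopic f <-> exists k : forall i, {linear X i -> Y i}, forall i x,
    f i x = k (i + 1) (diff X i (i + 1) x) - diff Y i (i + 1) (k i x).
Proof.
split=> [[h hP]|[k kP]].
  exists (fun i => (mk_lin (@deg_id_linear A Y (i - 1 + 1) i)) \o h i (i - 1)).
  move=> i x; rewrite hP addrC /=; congr (_ + - _).
    have E l m (y : X l) : m = i ->
        deg_id (i + 1) (h l m y : Y (m + 1)) = (h l i y : Y (i + 1)).
      by move=> ->; rewrite deg_id_refl.
    by rewrite E // addrK.
  by rewrite deg_id_diffl // subrK.
exists (fun i j => (mk_lin (@deg_id_linear A Y i (j + 1))) \o k i) => i x.
rewrite kP addrC /= deg_id_refl; congr (- _ + _).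
by rewrite deg_id_diffl // subrK.
Qed.

End HomotopyMaps.

Lemma cm_subE (A : pzRingType) (X Y : cochain A) (f g : chain_map X Y) i x :
  (f - g) i x = f i x - g i x.
Proof. by []. Qed.

Section Lifting.
Variable A : pzRingType.
Variables (T X Y Z : cochain A).
Variables (u : chain_map X Y) (v : chain_map Y Z).
Hypothesis Tproj : forall i, projective (T i).
Hypothesis u_inj : forall i x, u i x = 0 -> x = 0.
Hypothesis vu0 : forall i x, v i (u i x) = 0.
Hypothesis v_ker : forall i y, v i y = 0 -> exists x, u i x = y.
Hypothesis v_surj : forall i z, exists y, v i y = z.

Lemma ker_lift (M : lmodType A) i (g : {linear M -> Y i}) :
  (forall x, v i (g x) = 0) ->
  exists k : {linear M -> X i}, forall x, u i (k x) = g x.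
Proof.
move=> vg0; have [k kP] := choice (fun x => v_ker (vg0 x)).
have kl : linear k.
  move=> a x y; apply/eqP; rewrite -subr_eq0; apply/eqP; apply: (@u_inj i).
  by rewrite linearB linearP !kP linearP subrr.
by exists (mk_lin kl).
Qed.

Lemma proj_lift i j (f : {linear T i -> Z j}) :
  exists g : {linear T i -> Y j}, forall x, v j (g x) = f x.
Proof. exact: Tproj. Qed.

(* A degreewise lift g of f fails to be a chain map by a map into X[1], and a  *)
(* null homotopy of the latter corrects g.                                     *)
Lemma lift_chain_map (f : chain_map T Z) : Hom_zero T (shift 1 X) ->
  exists g : chain_map T Y, forall i x, v i (g i x) = f i x.
Proof.
move=> /Hom_zeroP H.
have [g gP] := dep_choice (fun i => proj_lift (f i)).
pose D i : {linear T i -> Y (i + 1)} :=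
  (diff Y i (i + 1) \o g i) \- (g (i + 1) \o diff T i (i + 1)).
have D0 i x : v (i + 1) (D i x) = 0.
  by rewrite /= linearB /= cmapP !gP cmapP subrr.
have [c cP] := dep_choice (fun i => ker_lift (D0 i)).
have cC i j x : c j (diff T i j x) = diff (shift 1 X) i j (c i x).
  have [ij|ij] := eqVneq j (i + 1); last by rewrite !diff_shape // linear0.
  subst j; apply/eqP; rewrite -subr_eq0; apply/eqP; apply: u_inj.
  rewrite -[diff (shift _ _) _ _ _]/(- diff X _ _ _).
  rewrite linearB linearN cmapP !cP /= diff_diff linear0 subr0.
  by rewrite linearB /= diff_diff sub0r opprK subrr.
have /null_homotopic_shift1[k kP] :=
  H (@ChainMap A T (shift 1 X) c cC).
pose g' i : {linear T i -> Y i} := g i \+ (u i \o k i).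
have gC i j x : g' j (diff T i j x) = diff Y i j (g' i x).
  have [ij|ij] := eqVneq j (i + 1); last by rewrite !diff_shape // linear0.
  subst j; have := cP i x; rewrite kP linearB /= => /eqP; rewrite subr_eq => /eqP E.
  by rewrite linearD /= -cmapP E addrA (addrC (g _ _)) subrK.
by exists (ChainMap gC) => i x; rewrite /= linearD /= gP vu0 addr0.
Qed.

Lemma Hom_zero_quotient :
  Hom_zero T (shift 1 X) -> Hom_zero T Y -> Hom_zero T Z.
Proof.
move=> HX /Hom_zeroP HY; apply/Hom_zeroP=> f.
have [g gP] := lift_chain_map f HX.
have -> : f = cm_comp v g by apply: chain_map_ext => i x; rewrite /= gP.
exact: null_homotopic_compl.
Qed.

(** Exactness at Hom(T, X[1]). The map u f is null homotopic through some h; then v h is a chain map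
    to Z, and subtracting from h a lift of v h to Y makes it land in X, where it contracts f. *)
Lemma Hom_zero_sub :
  (forall f : chain_map T Z,
     exists g : chain_map T Y, null_homotopic (cm_comp v g - f)) ->
  Hom_zero T (shift 1 Y) -> Hom_zero T (shift 1 X).
Proof.
move=> lift /Hom_zeroP HY; apply/Hom_zeroP=> f.
pose uf i : {linear T i -> Y (i + 1)} := u (i + 1) \o f i.
have ufC i j x : uf j (diff T i j x) = diff (shift 1 Y) i j (uf i x).
  rewrite -[diff (shift _ _) _ _ _]/(- diff Y _ _ _) /= cmapP.
  by rewrite -[diff (shift _ _) _ _ _]/(- diff X _ _ _) linearN cmapP.
have /null_homotopic_shift1[h hP] := HY (@ChainMap A T (shift 1 Y) uf ufC).
have vhC i j x : (v j \o h j) (diff T i j x) = diff Z i j ((v i \o h i) x).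
  have [ij|ij] := eqVneq j (i + 1); last by rewrite !diff_shape // linear0.
  subst j; have /= := hP i x => /(congr1 (v (i + 1))).
  by rewrite vu0 linearB /= cmapP => /esym/subr0_eq.
have [g [s sP]] := lift (@ChainMap A T Z (fun i => v i \o h i) vhC).
have [s' s'P] :=
  dep_choice (fun i => dep_choice (fun j => proj_lift (s i j))).
(* The lift g of v h is correct only up to the homotopy s. Lifting s through v by projectivity
   yields a chain map w with v w = v h exactly. *)
pose w := g - htp_map s'.
have vw i x : v i (w i x) = v i (h i x).
  rewrite -[w i x]/(_ - (_ + _)) linearB linearD /= cmapP !s'P.
  by rewrite -(sP i x) cm_subE /= opprB addrC subrK.
clearbody w.
have w0 i x : v i ((h i \- w i : {linear T i -> Y i}) x) = 0.
  by rewrite linearB vw subrr.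
have [k kP] := dep_choice (fun i => ker_lift (w0 i)).
have {}kP i x : u i (k i x) = h i x - w i x := kP i x.
apply/null_homotopic_shift1; exists k => i x.
apply/eqP; rewrite -subr_eq0; apply/eqP; apply: u_inj.
have /= uf_h := hP i x.
rewrite linearB linearB uf_h (cmapP u) !kP [diff Y _ _ (_ - _)]linearB -(cmapP w).
by rewrite (opprB (diff _ _ _ _) (w _ _)) addrA subrK subrr.
Qed.

End Lifting.

(** * Complexes over A / I *)

Section BarComplexes.
Variables (R : pzRingType) (A : pzAlgType R) (I : twoSidedIdeal A).
Local Notation Abar := (quot_alg I).
Local Notation res := (res_mod (alg_projm I)).

Program Definition res_cx (Z : cochain Abar) : cochain A :=
  @Cochain A (fun i => res (Z i))
    (fun i j => res_lin (alg_projm I) (diff Z i j)) _ _.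
Next Obligation. by move=> Z i j x ij; exact: diff_shape. Qed.
Next Obligation. by move=> Z i j k x; exact: diff_diff. Qed.

Section TransferMaps.
Variables (X W : cochain A) (Xb Z : cochain Abar).
Variables (p : chain_map X (res_cx Xb)) (phi : chain_map W (res_cx Z)).
Hypothesis ps : forall i y, exists x, p i x = y.
Hypothesis pk : forall i x, p i x = 0 -> x \in ideal_mul I (X i).

Lemma transfer_cm_up (f : chain_map X W) :
  exists fb : chain_map Xb Z, forall i x, fb i (p i x) = phi i (f i x).
Proof.
have [fb fbP] :=
  dep_choice (fun i => transfer_up (phi i) (@ps i) (@pk i) (f i)).
have fbC i j y : fb j (diff Xb i j y) = diff Z i j (fb i y).
  have [x <-] := ps y.
  rewrite -[diff Xb i j _]/(diff (res_cx Xb) i j _) -cmapP !fbP.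
  by rewrite cmapP cmapP.
by exists (ChainMap fbC).
Qed.

Lemma transfer_null_up (f : chain_map X W) (fb : chain_map Xb Z) :
  (forall i x, fb i (p i x) = phi i (f i x)) ->
  null_homotopic f -> null_homotopic fb.
Proof.
move=> fbP [h hP].
have [hb hbP] := dep_choice (fun i => dep_choice (fun j =>
  transfer_up (phi j) (@ps i) (@pk i) (h i j))).
exists hb => i y; have [x <-] := ps y.
rewrite -[diff Xb i _ _]/(diff (res_cx Xb) i _ _) -cmapP !hbP fbP hP.
by rewrite linearD; congr (_ + _); rewrite cmapP.
Qed.

Hypothesis phib : forall i, bijective (phi i).

Lemma transfer_cm_down (fb : chain_map Xb Z) :
  exists f : chain_map X W, forall i x, fb i (p i x) = phi i (f i x).
Proof.
have [f fP] := dep_choice (fun i => transfer_down (p i) (fb i) (phib i)).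
have fC i j x : f j (diff X i j x) = diff W i j (f i x).
  apply: (bij_inj (phib j)); rewrite fP (cmapP p) (cmapP phi) fP.
  exact: (cmapP fb).
by exists (ChainMap fC) => i x; rewrite /= fP.
Qed.

Lemma transfer_null (f : chain_map X W) (fb : chain_map Xb Z) :
  (forall i x, fb i (p i x) = phi i (f i x)) ->
  null_homotopic f <-> null_homotopic fb.
Proof.
move=> fbP; split; first exact: transfer_null_up.
case=> hb hbP.
have [h hP] := dep_choice (fun i => dep_choice (fun j =>
  transfer_down (p i) (hb i j) (phib j))).
exists h => i x; apply: (bij_inj (phib i)).
rewrite -fbP hbP linearD hP !cmapP hP.
by congr (_ + hb _ _ _).
Qed.

Lemma transfer_Hom_zero : Hom_zero X W <-> Hom_zero Xb Z.
Proof.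
split=> /Hom_zeroP H; apply/Hom_zeroP => f.
  by have [g /transfer_null gf] := transfer_cm_down f; exact/gf/H.
by have [g /transfer_null gf] := transfer_cm_up f; exact/gf/H.
Qed.

End TransferMaps.

Program Definition bar_cx_proj (X : cochain A) : chain_map X (res_cx (bar_cx I X)) :=
  @ChainMap A X (res_cx (bar_cx I X)) (fun i => @bar_projl R A I (X i)) _.
Next Obligation. by move=> X i j x; rewrite /= bar_mapE. Qed.

Program Definition quot_bar_cx (X : cochain A) :
    chain_map (quot_cx I X) (res_cx (bar_cx I X)) :=
  @ChainMap A (quot_cx I X) (res_cx (bar_cx I X)) (fun i => @quot_barl R A I (X i)) _.
Next Obligation. by []. Qed.

Program Definition quot_bar_shift n (X : cochain A) :
    chain_map (shift n (quot_cx I X)) (res_cx (shift n (bar_cx I X))) :=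
  @ChainMap A (shift n (quot_cx I X)) (res_cx (shift n (bar_cx I X)))
    (fun i => @quot_barl R A I (X (i + n))) _.
Next Obligation. by []. Qed.

Lemma quot_barl_bij (M : lmodType A) : bijective (@quot_barl R A I M).
Proof. by exists id. Qed.

Lemma quot_barl_ker (M : lmodType A) x :
  quot_barl I M x = 0 -> x \in ideal_mul I (quot_mod I M).
Proof. by move=> x0; have -> : x = 0 by []; exact: rpred0. Qed.

Lemma Hom_zero_bar_shift n (X : cochain A) :
  Hom_zero X (shift n (quot_cx I X)) <->
  Hom_zero (bar_cx I X) (shift n (bar_cx I X)).
Proof.
apply: (@transfer_Hom_zero _ _ _ _ (bar_cx_proj X) (quot_bar_shift n X)).
- by move=> i; exact: bar_projl_surj.
- by move=> i; exact: bar_projl_ker.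
- by move=> i; exact: quot_barl_bij.
Qed.

(** X/IX is already killed by I, so the transfer is along the identity on underlying groups. *)
Lemma Hom_zero_quot_bar_shift n (X : cochain A) :
  Hom_zero (quot_cx I X) (shift n (quot_cx I X)) <->
  Hom_zero (bar_cx I X) (shift n (bar_cx I X)).
Proof.
apply: (@transfer_Hom_zero _ _ _ _ (quot_bar_cx X) (quot_bar_shift n X)).
- by move=> i y; exists y.
- by move=> i; exact: quot_barl_ker.
- by move=> i; exact: quot_barl_bij.
Qed.

Program Definition bar_cm (X Y : cochain A) (f : chain_map X Y) :
    chain_map (bar_cx I X) (bar_cx I Y) :=
  @ChainMap _ (bar_cx I X) (bar_cx I Y)
    (fun i => @bar_map R A I (X i) (Y i) (f i)) _.
Next Obligation.
by move=> X Y f i j; elim/bar_ind=> x; rewrite /= !bar_mapE cmapP.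
Qed.

Lemma bar_cm_null (X Y : cochain A) (f : chain_map X Y) :
  null_homotopic f -> null_homotopic (bar_cm f).
Proof.
apply: (@transfer_null_up _ _ _ _ (bar_cx_proj X) (bar_cx_proj Y)).
- by move=> i; exact: bar_projl_surj.
- by move=> i; exact: bar_projl_ker.
- by move=> i x; exact: bar_mapE.
Qed.

Lemma bar_Kiso (X Y : cochain A) : Kiso X Y -> Kiso (bar_cx I X) (bar_cx I Y).
Proof.
move=> /KisoP[f [g [gf fg]]]; apply/KisoP; exists (bar_cm f), (bar_cm g).
have E U V (a : chain_map U V) (b : chain_map V U) :
    bar_cm (cm_comp b a - cm_id U) = cm_comp (bar_cm b) (bar_cm a) - cm_id _.
  apply: chain_map_ext => i; elim/bar_ind=> x.
  by rewrite cm_subE /= !bar_mapE -[LHS]/(bar_projl _ _ _) linearB.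
by rewrite -!E; split; exact: bar_cm_null.
Qed.

Lemma bar_shift_Kiso n (X : cochain A) :
  Kiso (bar_cx I (shift n X)) (shift n (bar_cx I X)).
Proof.
have fP i j x : idfun (diff (bar_cx I (shift n X)) i j x) =
                diff (shift n (bar_cx I X)) i j x.
  elim/bar_ind: x => x.
  rewrite -[RHS]/(shift_diff _ _) /= bar_mapE /= /shift_diff.
  case: (odd _); rewrite [in RHS]/= bar_mapE //.
  exact: (linearN (bar_projl I (X (j + n)))).
pose f := @ChainMap _ (bar_cx I (shift n X)) (shift n (bar_cx I X))
  (fun i => idfun) fP.
by apply: (@Kiso_bij _ _ _ f) => i; exists id.
Qed.

Lemma bar_dsum_Kiso (X Y : cochain A) :
  Kiso (bar_cx I (dsum X Y)) (dsum (bar_cx I X) (bar_cx I Y)).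
Proof.
have fP i j x : bar_pair I (X j) (Y j) (diff (bar_cx I (dsum X Y)) i j x) =
    diff (dsum (bar_cx I X) (bar_cx I Y)) i j (bar_pair I (X i) (Y i) x).
  elim/bar_ind: x => -[x y].
  rewrite -[diff (bar_cx _ _) _ _ _]/(bar_map _ _) bar_mapE !bar_pairE.
  by congr (_, _); rewrite /= bar_mapE.
pose f := @ChainMap _ (bar_cx I (dsum X Y)) (dsum (bar_cx I X) (bar_cx I Y))
  (fun i => bar_pair I (X i) (Y i)) fP.
apply: (@Kiso_bij _ _ _ f) => i; exact: bar_pair_bij.
Qed.

Lemma bar_copies_Kiso n (X : cochain A) :
  Kiso (bar_cx I (copies n X)) (copies n (bar_cx I X)).
Proof.
have fP i j x : bar_ffun I (X j) n (diff (bar_cx I (copies n X)) i j x) =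
    diff (copies n (bar_cx I X)) i j (bar_ffun I (X i) n x).
  elim/bar_ind: x => x.
  rewrite -[diff (bar_cx _ _) _ _ _]/(bar_map _ _) bar_mapE.
  apply/ffunP=> k; rewrite bar_ffunE [RHS]ffunE bar_ffunE [RHS]bar_mapE.
  by rewrite /= ffunE.
pose f := @ChainMap _ (bar_cx I (copies n X)) (copies n (bar_cx I X))
  (fun i => bar_ffun I (X i) n) fP.
apply: (@Kiso_bij _ _ _ f) => i; exact: bar_ffun_bij.
Qed.

Lemma bar_deg_id (X : cochain A) i j (x : X i) :
  @deg_id _ (bar_cx I X) i j (bar_proj I x) = bar_proj I (deg_id j x).
Proof.
have [ij|ij] := eqVneq i j; first by subst j; rewrite !deg_id_refl.
by rewrite !deg_id_neq // -[RHS]/(bar_projl I _ _) linear0.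
Qed.

Lemma bar_cone_Kiso (X Y : cochain A) (f : chain_map X Y) :
  Kiso (bar_cx I (cone f)) (cone (bar_cm f)).
Proof.
have fP i j x : bar_pair I (X (j + 1)) (Y j) (diff (bar_cx I (cone f)) i j x) =
    diff (cone (bar_cm f)) i j (bar_pair I (X (i + 1)) (Y i) x).
  elim/bar_ind: x => -[x y].
  rewrite -[diff (bar_cx _ _) _ _ _]/(bar_map _ _) bar_mapE !bar_pairE.
  congr (_, _); rewrite /= !bar_mapE ?bar_deg_id.
    by rewrite -[LHS]/(bar_projl I _ _) linearN.
  by rewrite -bar_modD.
pose fb := @ChainMap _ (bar_cx I (cone f)) (cone (bar_cm f))
  (fun i => bar_pair I (X (i + 1)) (Y i)) fP.
apply: (@Kiso_bij _ _ _ fb) => i; exact: bar_pair_bij.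
Qed.

Lemma bar_perfect (X : cochain A) : perfect X -> perfect (bar_cx I X).
Proof.
move=> [[N XN] Xp]; split.
  exists N => i iN; elim/bar_ind=> x; rewrite (XN i iN x).
  exact: (linear0 (bar_projl I (X i))).
by move=> i; have [fg pr] := Xp i; split; [exact: bar_fin_gen|exact: bar_projective].
Qed.

End BarComplexes.

(** * Pulling back triangulated subcategories *)

Section Perfect.
Variable A : pzRingType.
Implicit Types X Y : cochain A.

Lemma pair_fin_gen (U V : lmodType A) :
  fin_gen U -> fin_gen V -> fin_gen (U * V)%type.
Proof.
move=> [m [g gP]] [n [h hP]]; exists (m + n)%N.
exists (fun k => match split k with inl i => (g i, 0) | inr j => (0, h j) end).
case=> x y; have [c xE] := gP x; have [d yE] := hP y.
exists (fun k => match split k with inl i => c i | inr j => d j end).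
rewrite big_split_ord /=.
under eq_bigr => i _.
  rewrite -[lshift n i]/(unsplit (inl _ i)) unsplitK.
  rewrite -[(g i, 0)]/(pair_inl _ _ (g i)) -linearZ. over.
under [X in _ = _ + X]eq_bigr => i _.
  rewrite -[rshift m i]/(unsplit (inr _ i)) unsplitK.
  rewrite -[(0, h i)]/(pair_inr _ _ (h i)) -linearZ. over.
rewrite -!linear_sum -xE -yE.
by congr (_, _); rewrite /= ?addr0 ?add0r.
Qed.

Lemma pair_projective (U V : lmodType A) :
  projective U -> projective V -> projective (U * V)%type.
Proof.
move=> PU PV M N p f ps.
have [g gP] := PU M N p (f \o pair_inl U V) ps.
have [h hP] := PV M N p (f \o pair_inr U V) ps.
exists ((g \o pair_fst U V) \+ (h \o pair_snd U V)) => -[x y].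
rewrite linearD /= gP hP /= -linearD; congr (f _).
by congr (_, _); rewrite /= ?addr0 ?add0r.
Qed.

Lemma perfect_shift n X : perfect X -> perfect (shift n X).
Proof.
move=> [[N XN] Xp]; split; last by move=> i; exact: Xp.
by exists (N + `|n|)%N => i iN x; apply: XN; lia.
Qed.

Lemma perfect_cone X Y (f : chain_map X Y) :
  perfect X -> perfect Y -> perfect (cone f).
Proof.
move=> [[N XN] Xp] [[M YM] Yp]; split.
  exists (N + M + 1)%N => i iN [x y].
  by congr (_, _); [apply: XN | apply: YM]; lia.
move=> i; have [Xg Xpr] := Xp (i + 1); have [Yg Ypr] := Yp i.
by split; [exact: pair_fin_gen | exact: pair_projective].
Qed.

End Perfect.

Section Pullback.
Variables (R : pzRingType) (A : pzAlgType R) (I : twoSidedIdeal A).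
Variable P : cochain (quot_alg I) -> Prop.
Hypothesis Ptri : triangulated_subcat P.

(** Reduction modulo I preserves perfect complexes and homotopy equivalences, and commutes with
    shifts and cones up to isomorphism. *)
Lemma triangulated_pullback :
  triangulated_subcat (fun X : cochain A => perfect X /\ P (bar_cx I X)).
Proof.
split=> [X []//|X Y [Xp PX] Yp XY|X n [Xp PX]|X Y f [Xp PX] [Yp PY]].
- split=> //; apply: (tri_iso Ptri PX); first exact: bar_perfect.
  exact: bar_Kiso.
- have p := perfect_shift n Xp; split=> //.
  apply: (tri_iso Ptri (tri_shift Ptri n PX)); first exact: bar_perfect.
  exact/Kiso_sym/bar_shift_Kiso.
- have p := perfect_cone f Xp Yp; split=> //.
  apply: (tri_iso Ptri (tri_cone Ptri (bar_cm I f) PX PY)).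
    exact: bar_perfect.
  exact/Kiso_sym/bar_cone_Kiso.
Qed.

Lemma in_add_bar (T X : cochain A) :
  in_add T X -> in_add (bar_cx I T) (bar_cx I X).
Proof.
move=> [Xp [n [Y [Yp XY]]]]; split; first exact: bar_perfect.
exists n, (bar_cx I Y); split; first exact: bar_perfect.
apply: (Kiso_trans (Kiso_sym (bar_dsum_Kiso I X Y))).
exact: (Kiso_trans (bar_Kiso I XY) (bar_copies_Kiso I n T)).
Qed.

Lemma generates_bar (T : cochain A) :
  generates (in_add T) -> (forall X, in_add (bar_cx I T) X -> P X) ->
  forall X, perfect X -> P (bar_cx I X).
Proof.
move=> gT TP X /(gT _ triangulated_pullback)[]// {}X TX.
by split; [case: TX | exact/TP/in_add_bar].
Qed.

End Pullback.

(** * Brutal truncation *)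

Section Cut.
Variable A : pzRingType.

Section CutModule.
Variables (b : bool) (M : lmodType A).
Fact cut_end_linear : linear (fun x : M => if b then x else 0).
Proof. by move=> a x y; case: b; rewrite // scaler0 addr0. Qed.
Definition cut_end := mk_lin cut_end_linear.
Fact cut_end_idem x : cut_end (cut_end x) = cut_end x.
Proof. by rewrite /=; case: b. Qed.
(** M or 0 according to b, encoded as the fixed points of an idempotent: the terms of a truncation
    are then uniform in the degree, without case analysis on types, and are retracts of the original
    terms. *)
Definition cutmod := fixmod cut_end.
HB.instance Definition _ := GRing.Lmodule.on cutmod.
Definition cut_val : {linear cutmod -> M} := fix_val cut_end.
Definition cut_in : {linear M -> cutmod} := fix_in cut_end_idem.
Lemma cut_val_inj : injective cut_val.
Proof. exact: fix_val_inj. Qed.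
Lemma cut_inK x : cut_in (cut_val x) = x.
Proof. exact: fix_inK. Qed.
Lemma cut_valK x : cut_val (cut_in x) = if b then x else 0.
Proof. by []. Qed.
Lemma cut_valP x : (if b then cut_val x else 0) = cut_val x.
Proof. exact: (fix_valP x). Qed.
Lemma cut_val0 (x : cutmod) : ~~ b -> cut_val x = 0.
Proof. by rewrite -cut_valP => /negPf ->. Qed.
End CutModule.

Variables (p : pred int) (X : cochain A).

Program Definition cut : cochain A :=
  @Cochain A (fun i => cutmod (p i) (X i))
    (fun i j => cut_in (p j) (X j) \o (diff X i j \o cut_val (p i) (X i))) _ _.
Next Obligation.
move=> i j x ij; apply: cut_val_inj.
by rewrite linear0 -[LHS]/(if p j then diff X i j _ else 0) diff_shape // if_same.
Qed.
Next Obligation.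
move=> i j k x; apply: cut_val_inj.
rewrite linear0 -[LHS]/(if p k then diff X j k (if p j then diff X i j _ else 0) else 0).
by case: (p k) => //; case: (p j); rewrite ?diff_diff ?linear0.
Qed.

Lemma cut_diffE i j x :
  cut_val (p j) (X j) (diff cut i j x) =
  if p j then diff X i j (cut_val (p i) (X i) x) else 0.
Proof. by []. Qed.

Lemma perfect_cut : perfect X -> perfect cut.
Proof.
move=> [[N XN] Xp]; split.
  by exists N => i iN x; apply: cut_val_inj; rewrite linear0; exact: XN.
move=> i; have [g pr] := Xp i; split.
  exact: (fixmod_fin_gen (@cut_end_idem (p i) (X i)) g).
exact: (fixmod_projective (@cut_end_idem (p i) (X i)) pr).
Qed.

End Cut.

Lemma stalk_diff0 (A : pzRingType) (X : cochain A) k i j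
  (x : cut (fun i => i == k) X i) : diff (cut (fun i => i == k) X) i j x = 0.
Proof.
have [ij|ij] := eqVneq j (i + 1); last by rewrite diff_shape.
apply: cut_val_inj; rewrite cut_diffE linear0; case: eqP => // jk.
by rewrite cut_val0 ?linear0 //; lia.
Qed.

Definition const_cx (A : pzRingType) (M : lmodType A) : cochain A :=
  @Cochain A (fun=> M) (fun _ _ => \0) (fun _ _ _ _ => erefl)
    (fun _ _ _ _ => erefl).

Definition stalk_cx (A : pzRingType) (M : lmodType A) (k : int) : cochain A :=
  cut (fun i => i == k) (const_cx M).

Lemma stalk_bounded (A : pzRingType) (M : lmodType A) k :
  bounded (stalk_cx M k).
Proof.
exists `|k|%N => i ik x; apply: cut_val_inj; rewrite linear0.
by apply: cut_val0; lia.
Qed.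

Lemma stalk_fin_gen (A : pzRingType) (M : lmodType A) k i :
  fin_gen M -> fin_gen (stalk_cx M k i).
Proof. exact: (fixmod_fin_gen (@cut_end_idem _ (i == k) M)). Qed.

Lemma perfect_stalk (A : pzRingType) (M : lmodType A) k :
  fin_gen M -> projective M -> perfect (stalk_cx M k).
Proof.
move=> Mg Mp; split=> [|i]; first exact: stalk_bounded.
split; first exact: stalk_fin_gen.
exact: (fixmod_projective (@cut_end_idem _ (i == k) M)).
Qed.

Section Truncation.
Variable (A : pzRingType) (X : cochain A).
Local Notation trunc k := (cut (fun i : int => k <= i) X).
Local Notation stalk k := (cut (fun i : int => i == k) X).

(* The differential X^k -> X^(k+1) as a map from X^k[-k-1], whose cone is the  *)
(* brutal truncation at k.                                                     *)
Fact trunc_map_subproof k i j x :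
  (cut_in (k + 1 <= j) (X j) \o (diff X (j - 1) j \o cut_val (j - 1 == k) (X (j - 1))))
    (diff (shift (-1) (stalk k)) i j x) =
  diff (trunc (k + 1)) i j
    ((cut_in (k + 1 <= i) (X i) \o (diff X (i - 1) i \o cut_val (i - 1 == k) (X (i - 1)))) x).
Proof.
apply: cut_val_inj; rewrite cut_diffE.
rewrite -[LHS]/(if k + 1 <= j then diff X (j - 1) j (cut_val (j - 1 == k)
  (X (j - 1)) (diff (shift (-1) (stalk k)) i j x)) else 0).
rewrite -[RHS]/(if k + 1 <= j then diff X i j (if k + 1 <= i then
  diff X (i - 1) i (cut_val (i - 1 == k) (X (i - 1)) x) else 0) else 0).
have -> : diff X i j (if k + 1 <= i then diff X (i - 1) i (cut_val _ _ x) else 0) = 0.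
  by case: ifP; rewrite ?diff_diff ?linear0.
rewrite if_same; case: ifP => // _.
rewrite -[diff (shift _ _) i j x]/(- diff (stalk k) (i - 1) (j - 1) x).
by rewrite stalk_diff0 oppr0 !linear0.
Qed.
Definition trunc_map k : chain_map (shift (-1) (stalk k)) (trunc (k + 1)) :=
  @ChainMap A (shift (-1) (stalk k)) (trunc (k + 1))
    (fun i => cut_in (k + 1 <= i) (X i) \o
       (diff X (i - 1) i \o cut_val (i - 1 == k) (X (i - 1))))
    (@trunc_map_subproof k).

(** The first factor of the cone lives only in degree k and the second only above k, so the evident
    degreewise map is bijective. The first factor is indexed by i + 1 - 1, hence the transports
    [deg_id]. *)
Lemma trunc_cone_Kiso k : Kiso (trunc k) (cone (trunc_map k)).
Proof.
pose f1 i : {linear trunc k i -> _} := cut_in (i + 1 - 1 == k) (X (i + 1 - 1)) \o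
  (mk_lin (@deg_id_linear A X i (i + 1 - 1)) \o cut_val (k <= i) (X i)).
pose f2 i : {linear trunc k i -> _} :=
  cut_in (k + 1 <= i) (X i) \o cut_val (k <= i) (X i).
have fl i : linear ((fun x => (f1 i x, f2 i x)) : trunc k i -> cone (trunc_map k) i).
  by move=> a x y; congr (_, _); exact: linearP.
have f1E i x : cut_val _ _ (f1 i x) =
  if i + 1 - 1 == k then deg_id (i + 1 - 1) (cut_val (k <= i) (X i) x) else 0 by [].
have f2E i x : cut_val _ _ (f2 i x) =
  if k + 1 <= i then cut_val (k <= i) (X i) x else 0 by [].
have fC i j x : mk_lin (fl j) (diff (trunc k) i j x) =
                diff (cone (trunc_map k)) i j (mk_lin (fl i) x).
  have [ij|ij] := eqVneq j (i + 1); last by rewrite !diff_shape // linear0.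
  subst j; congr (_, _); apply: cut_val_inj.
    rewrite f1E cut_diffE.
    rewrite -[diff (shift _ _) _ _ _]/(- diff (stalk k) (i + 1 - 1)
      (i + 1 + 1 - 1) (f1 i x)).
    rewrite stalk_diff0 !oppr0 linear0; case: eqP => // e.
    by rewrite (cut_val0 x) ?linear0 ?if_same ?linear0 //; lia.
  rewrite f2E cut_diffE linearD deg_id_refl cut_diffE f2E.
  rewrite -[cut_val _ _ (trunc_map k _ _)]/(if k + 1 <= i + 1 then
    diff X (i + 1 - 1) (i + 1) (cut_val _ _ (f1 i x)) else 0) f1E.
  have [ki|ki] := orP (orbN (k <= i)); last first.
    by rewrite (cut_val0 x) // !(if_same, linear0) addr0.
  have h1 : k + 1 <= i + 1 by lia.
  have h2 : k <= i + 1 by lia.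
  rewrite !(ifT _ _ h1) (ifT _ _ h2).
  have [ki1|ki1] := orP (orbN (k + 1 <= i)).
    have h3 : (i + 1 - 1 == k) = false by lia.
    by rewrite (ifF _ _ h3) (ifT _ _ ki1) ?linear0 ?add0r.
  have h3 : i + 1 - 1 == k by lia.
  rewrite (ifT _ _ h3) (ifF _ _ (negbTE ki1)).
  by rewrite deg_id_diffl ?linear0 ?addr0 // addrK.
pose F := @ChainMap A (trunc k) (cone (trunc_map k)) (fun i => mk_lin (fl i)) fC.
apply: (@Kiso_bij _ _ _ F) => i.
exists (fun u => cut_in (k <= i) (X i) (deg_id i (cut_val _ _ u.1) + cut_val _ _ u.2)).
  move=> x; apply: cut_val_inj; rewrite cut_valK f1E f2E.
  have [ki|ki] := orP (orbN (k <= i)); last first.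
    by rewrite (cut_val0 x) // (ifF _ _ (negbTE ki)).
  rewrite (ifT _ _ ki).
  have [ki1|ki1] := orP (orbN (k + 1 <= i)).
    have h3 : (i + 1 - 1 == k) = false by lia.
    by rewrite (ifF _ _ h3) (ifT _ _ ki1) ?linear0 ?add0r.
  have h3 : i + 1 - 1 == k by lia.
  rewrite (ifT _ _ h3) (ifF _ _ (negbTE ki1)).
  by rewrite deg_idK ?addr0 // addrK.
move=> [s y]; congr (_, _); apply: cut_val_inj.
  rewrite f1E cut_valK; have [ki|ki] := orP (orbN (i + 1 - 1 == k)); last first.
    by rewrite (cut_val0 s) // (ifF _ _ (negbTE ki)).
  have h3 : k <= i by lia.
  rewrite (ifT _ _ ki) (ifT _ _ h3).
  by rewrite (cut_val0 y) ?addr0 ?deg_idK ?addrK //; lia.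
rewrite f2E cut_valK; have [ki|ki] := orP (orbN (k + 1 <= i)); last first.
  by rewrite (cut_val0 y) // (ifF _ _ (negbTE ki)).
have h3 : k <= i by lia.
rewrite (ifT _ _ ki) (ifT _ _ h3).
by rewrite (cut_val0 s) ?linear0 ?add0r //; lia.
Qed.

End Truncation.

Lemma generated_by_stalks (A : pzRingType) (P : cochain A -> Prop) :
  triangulated_subcat P ->
  (forall X k, perfect X -> (forall i, i != k -> forall x : X i, x = 0) -> P X) ->
  forall X, perfect X -> P X.
Proof.
move=> Ptri Pstalk X Xp; have [[N XN] _] := Xp.
have trunc_in m : P (cut (fun i : int => (N.+1%:Z - m%:Z <= i)%R) X).
  elim: m => [|m IHm].
    (* The truncation from N + 1 upwards is zero, so it counts as concentrated in degree 0. *)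
    apply: (Pstalk _ 0); first exact: perfect_cut.
    move=> i _ x; apply: cut_val_inj; rewrite linear0.
    have [iN|iN] := leqP `|i|%N N; last exact: XN.
    by apply: cut_val0; lia.
  have E : N.+1%:Z - m%:Z = N.+1%:Z - m.+1%:Z + 1 by lia.
  rewrite {}E in IHm; set k := N.+1%:Z - m.+1%:Z in IHm *.
  have kp : perfect (cut (fun i : int => k <= i) X) := perfect_cut _ Xp.
  apply: (tri_iso Ptri _ kp (Kiso_sym (trunc_cone_Kiso X k))).
  apply: (tri_cone Ptri) => //; apply: (tri_shift Ptri).
  apply: (Pstalk _ k); first exact: perfect_cut.
  move=> i ik x; apply: cut_val_inj; rewrite linear0.
  exact: cut_val0.
(* From N + 1, descending 2 (N + 1) steps reaches -(N + 1), below every nonzero term. *)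
apply: (tri_iso Ptri (trunc_in (2 * N.+1)%N) Xp).
set p := (fun i : int => _).
have fC i j x : cut_val (p j) (X j) (diff (cut p X) i j x) =
                diff X i j (cut_val (p i) (X i) x).
  rewrite cut_diffE /p; case: ifP => // ij.
  by rewrite [RHS]XN //; lia.
pose f := @ChainMap A (cut p X) X (fun i => cut_val (p i) (X i)) fC.
apply: (@Kiso_bij _ _ _ f) => i; exists (cut_in (p i) (X i)).
  exact: cut_inK.
move=> x; rewrite [LHS]cut_valK /p; case: ifP => // ij.
by rewrite [RHS]XN //; lia.
Qed.

(** * Descending chains *)

Section DescendingChains.
Variable R : pzRingType.
Implicit Types M N : lmodType R.

Record submodule M (S : M -> Prop) : Prop := Submodule {
  submodule0 : S 0;
  submoduleP : forall a x y, S x -> S y -> S (a *: x + y)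
}.

(** Relative to an ambient bound K, so that K can be cut down by one kernel after another in an
    induction. *)
Definition dcc_on M (K : M -> Prop) : Prop :=
  forall S : nat -> M -> Prop, (forall n, submodule (S n)) ->
    (forall n x, S n x -> K x) -> (forall n x, S n.+1 x -> S n x) ->
    exists n, forall m x, (n <= m)%N -> S n x -> S m x.

Definition dcc M := dcc_on (fun _ : M => True).

Lemma chain_leq (T : Type) (S : nat -> T -> Prop) :
  (forall n x, S n.+1 x -> S n x) ->
  forall m n x, (m <= n)%N -> S n x -> S m x.
Proof.
move=> Sd m n x /subnKC <-; elim: (n - m)%N => [|k IH]; first by rewrite addn0.
by rewrite addnS => /Sd.
Qed.

Lemma submoduleB M (S : M -> Prop) x y : submodule S -> S x -> S y -> S (x - y).
Proof.
by move=> Ssub Sx Sy; rewrite addrC -scaleN1r; apply: (submoduleP Ssub).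
Qed.

Lemma dcc_surj M N (f : {linear M -> N}) :
  (forall y, exists x, f x = y) -> dcc M -> dcc N.
Proof.
move=> fs MD S Ssub _ Sd.
have [||//|n nP] := MD (fun n x => S n (f x)).
- move=> n; split; first by rewrite linear0; exact: (submodule0 (Ssub n)).
  by move=> a x y Sx Sy; rewrite linearP; exact: (submoduleP (Ssub n)).
- by [].
- by move=> n x; exact: Sd.
by exists n => m y nm; have [x <-] := fs y; exact: nP.
Qed.

(** Nested submodules with the same image under f and the same intersection with its kernel
    coincide. *)
Lemma dcc_on_ker M N (K : M -> Prop) (f : {linear M -> N}) :
  dcc N -> dcc_on (fun x => K x /\ f x = 0) -> dcc_on K.
Proof.
move=> ND KD S Ssub SK Sd.
have [||//|n nP] := ND (fun n y => exists2 x, S n x & f x = y).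
- move=> n; split; first by exists 0; [exact: (submodule0 (Ssub n))|exact: linear0].
  move=> a _ _ [x Sx <-] [y Sy <-]; exists (a *: x + y); last exact: linearP.
  exact: (submoduleP (Ssub n)).
- by [].
- by move=> n y [x Sx <-]; exists x => //; exact: Sd.
have [||//|m mP] := KD (fun n x => S n x /\ f x = 0).
- move=> k; split; first by split; [exact: (submodule0 (Ssub k))|exact: linear0].
  move=> a x y [Sx fx] [Sy fy].
  by split; [exact: (submoduleP (Ssub k)) | rewrite linearP fx fy scaler0 addr0].
- by move=> k x [Sx fx]; split=> //; exact: SK Sx.
- by move=> k x [Sx fx]; split=> //; exact: Sd.
exists (maxn n m) => k x; rewrite geq_max => /andP[nk mk] Sx.
have [|y Sy fy] := nP k (f x) nk.
  by exists x => //; exact: (chain_leq Sd (leq_maxl n m)).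
rewrite -(subrK y x); rewrite -[x - y]scale1r.
apply: (submoduleP (Ssub k)) => //; apply: (mP k (x - y) mk _).1.
split; last by rewrite linearB fy subrr.
apply: submoduleB => //; first exact: (chain_leq Sd (leq_maxr n m)).
exact: (chain_leq Sd mk).
Qed.

Lemma dcc_on_kers M (K : M -> Prop) (N : nat -> lmodType R)
    (f : forall k, {linear M -> N k}) n :
  (forall k, (k < n)%N -> dcc (N k)) ->
  dcc_on (fun x => K x /\ forall k, (k < n)%N -> f k x = 0) -> dcc_on K.
Proof.
elim: n K => [|n IH] K ND KD.
  move=> S Ssub SK; apply: KD => // n x Sx; split=> //; exact: SK Sx.
apply: (IH K) => [k kn|]; first by apply: ND; exact: ltnW.
apply: (dcc_on_ker (f := f n)); first exact: ND.
move=> S Ssub SK; apply: KD => // m x /SK[[Kx fx] fnx]; split=> // k.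
by rewrite ltnS leq_eqVlt => /predU1P[->//|]; exact: fx.
Qed.

Lemma dcc_on0 M (K : M -> Prop) : (forall x, K x -> x = 0) -> dcc_on K.
Proof.
move=> K0 S Ssub SK Sd; exists 0%N => m x _ /SK/K0 ->.
exact: (submodule0 (Ssub m)).
Qed.

Lemma dcc_ffun M n : dcc M -> dcc {ffun 'I_n -> M}.
Proof.
move=> MD; case: n => [|n].
  by apply: dcc_on0 => x _; apply/ffunP => -[].
apply: (dcc_on_kers (N := fun=> M) (f := fun k => ffun_eval M (inord k : 'I_n.+1))
  (n := n.+1)) => //.
apply: dcc_on0 => x [_ x0]; apply/ffunP=> k; rewrite ffunE.
by rewrite -(inord_val k); exact: x0.
Qed.

(** The images of the powers of f stabilise, so f^n y = f^(n+1) x for some n and x; cancel f^n. *)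
Lemma dcc_inj_surj M (f : {linear M -> M}) :
  dcc M -> injective f -> forall y, exists x, f x = y.
Proof.
move=> MD finj y.
have [||//|n nP] := MD (fun n x => exists z, iter n f z = x).
- move=> n; split; first by exists 0; elim: n => //= n ->; exact: linear0.
  move=> a _ _ [x <-] [z <-]; exists (a *: x + z).
  by elim: n => //= n ->; exact: linearP.
- by [].
- by move=> n _ [z <-]; exists (f z); rewrite -iterSr.
have [|x xE] := nP n.+1 (iter n f y) (leqnSn n); first by exists y.
exists x; move: xE; rewrite iterSr; elim: n {nP} => //= n IH /finj; exact: IH.
Qed.

End DescendingChains.

(** By commutativity the submodules of [R^o] are the two-sided ideals in which [artinian] is
    phrased. *)
Lemma artinian_dcc (R : comPzRingType) : artinian R -> dcc R^o.
Proof.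
move=> RA S Ssub _ Sd.
pose I n : {pred R} := fun x => `[< S n x >].
have IP n x : reflect (S n x) (x \in I n) by exact: asboolP.
have Iz n : zmod_closed (I n).
  split; first by apply/IP; exact: (submodule0 (Ssub n)).
  move=> x y /IP Sx /IP Sy; apply/(IP n (x - y)). exact: (submoduleB (Ssub n)).
have Il n (a x : R) : x \in I n -> a * x \in I n.
  move=> /IP Sx; apply/IP; rewrite -[a * x]addr0.
  by apply: (submoduleP (Ssub n)) => //; exact: (submodule0 (Ssub n)).
have Ir n (a x : R) : x \in I n -> x * a \in I n.
  by rewrite mulrC; exact: Il.
pose J n : twoSidedIdeal R := HB.pack (I n : R -> bool)
  (GRing.isZmodClosed.Build R (I n) (Iz n)) (isTwoSided.Build R (I n) (@Il n) (@Ir n)).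
have [|n nP] := RA J.
  by move=> n x /IP Sx; apply/IP; exact: Sd.
exists n => m x nm Sx; apply/IP; rewrite -[x \in I m]/(x \in J m) nP //.
exact/IP.
Qed.

(** * Chain conditions over an Artin algebra *)

Section ArtinAlgebra.
Variables (R : comPzRingType).

Lemma fin_gen_dcc (S A : pzRingType) (s : {rmorphism S -> A}) (M : lmodType A) :
  dcc (res_mod s A^o) -> fin_gen M -> dcc (res_mod s M).
Proof.
move=> AD [n [g gP]].
have fl : linear ((fun c => \sum_i (c i : A) *: g i) :
    {ffun 'I_n -> res_mod s A^o} -> res_mod s M).
  move=> a x y; rewrite scaler_sumr -big_split; apply: eq_bigr => k _ /=.
  by rewrite !ffunE scalerDl -scalerA.
apply: (dcc_surj (f := mk_lin fl)); last exact: dcc_ffun.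
move=> y; have [c ->] := gP y; exists [ffun i => c i].
by apply: eq_bigr => i _; rewrite ffunE.
Qed.

Lemma artin_algebra_dcc (A : pzAlgType R) :
  artin_algebra A -> dcc (base_mod A).
Proof.
move=> [/artinian_dcc RD [n [g gP]]].
apply: (dcc_surj (f := ffun_gen g)); last exact: dcc_ffun.
move=> y; have [c ->] := gP y; exists [ffun i => c i].
by apply: eq_bigr => i _; rewrite ffunE.
Qed.

Lemma artin_algebra_res_dcc (A : pzAlgType R) (M : lmodType A) :
  artin_algebra A -> fin_gen M -> dcc (res_mod (@alg_map R A) M).
Proof.
move=> /artin_algebra_dcc AD; apply: fin_gen_dcc.
have fl : linear (id : base_mod A -> res_mod (@alg_map R A) A^o) by [].
by apply: (dcc_surj (f := mk_lin fl)) => // y; exists y.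
Qed.

(** An endomorphism is determined by its values on generators of the terms in degrees -N to N. These
    are finitely many R-linear evaluations into modules with the descending chain condition, and
    their common kernel is zero. *)
Lemma cend_dcc (A : pzAlgType R) (X : cochain A) :
  artin_algebra A -> bounded X -> (forall i, fin_gen (X i)) ->
  dcc (base_mod (cend X)).
Proof.
move=> Aart [N XN] Xg.
pose d k : int := k%:Z - N%:Z.
have step n : dcc_on (fun c : base_mod (cend X) => True /\
    forall k, (k < n)%N -> forall x, (c : cend X) (d k) x = 0) -> dcc (base_mod (cend X)).
  elim: n => [|n IH] D.
    by move=> S Ssub _; apply: D => // n x _; split.
  apply: IH; have [m [g gP]] := Xg (d n).
  (* An empty generating family means a zero term; it is treated apart because [inord] needs a
     nonempty index type. *)
  case: m g gP => [|m] g gP.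
    move=> S Ssub SK; apply: D => // l c /SK[_ c0]; split=> // k.
    rewrite ltnS leq_eqVlt => /predU1P[->|]; last exact: c0.
    by move=> x; have [a ->] := gP x; rewrite big_ord0 linear0.
  have el k : linear ((fun c : base_mod (cend X) => (c : cend X) (d n) (g (inord k)))
       : base_mod (cend X) -> res_mod (@alg_map R A) (X (d n))).
    by [].
  apply: (dcc_on_kers (f := fun k => mk_lin (el k)) (n := m.+1)).
    by move=> k _; exact: artin_algebra_res_dcc.
  move=> S Ssub SK; apply: D => // l c /SK[[_ c0] cg]; split=> // k.
  rewrite ltnS leq_eqVlt => /predU1P[->|]; last exact: c0.
  move=> x; have [a ->] := gP x; rewrite linear_sum big1 // => i _.
  by rewrite linearZ -(inord_val i) /= [X in _ *: X]cg ?scaler0.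
apply: (step (2 * N).+1); apply: dcc_on0 => c [_ c0].
apply: chain_map_ext => i x.
have [iN|iN] := leqP `|i|%N N; last by rewrite (XN i iN x) !linear0.
have e : i = d (absz (i + N%:Z)) by rewrite /d; lia.
have c00 : forall y : X i, c i y = 0 by rewrite e; apply: c0; lia.
exact: c00.
Qed.

Lemma KEnd_dcc (A : pzAlgType R) (X : cochain A) :
  artin_algebra A -> bounded X -> (forall i, fin_gen (X i)) ->
  dcc (base_mod (KEnd X)).
Proof.
move=> Aart Xb Xg.
have pl : linear ((fun c => alg_proj (cend_null X) c)
    : base_mod (cend X) -> base_mod (KEnd X)).
  by move=> a x y; rewrite quot_algD -quot_mulE.
apply: (dcc_surj (f := mk_lin pl)); last exact: cend_dcc.
exact: alg_proj_surj.
Qed.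

Lemma quot_artin_algebra (A : pzAlgType R) (I : twoSidedIdeal A) :
  artin_algebra A -> artin_algebra (quot_alg I : pzAlgType R).
Proof.
move=> [RA Ag]; split=> //.
have pl : linear ((fun a => alg_proj I a) : base_mod A -> base_mod (quot_alg I)).
  by move=> a x y; rewrite quot_algD -quot_mulE.
by apply: (fin_gen_surj (p := mk_lin pl)) => //; exact: alg_proj_surj.
Qed.

End ArtinAlgebra.

(** * Lifting projective modules *)

Section Fitting.
Variable R : comPzRingType.

Lemma dcc_power_stable (C : pzAlgType R) (a : C) : dcc (base_mod C) ->
  exists n, forall m, (n <= m)%N -> exists x, a ^+ n = a ^+ m * x.
Proof.
move=> CD.
have [||//|n nP] := CD (fun n z => exists x, z = a ^+ n * x :> C).
- move=> n; split; first by exists 0; rewrite mulr0.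
  move=> r _ _ [x ->] [y ->]; exists (alg_map r * x + y).
  rewrite mulrDr; congr (_ + _).
  by rewrite [LHS]mulrA alg_map_central -!mulrA alg_map_central.
- by [].
- by move=> n _ [x ->]; exists (a * x); rewrite exprSr mulrA.
exists n => m nm; apply: (nP m (a ^+ n) nm); by exists 1; rewrite mulr1.
Qed.

Lemma dcc_power_stable_l (C : pzAlgType R) (a : C) : dcc (base_mod C) ->
  exists n, forall m, (n <= m)%N -> exists y, a ^+ n = y * a ^+ m.
Proof.
move=> CD.
have [||//|n nP] := CD (fun n z => exists y, z = y * a ^+ n :> C).
- move=> n; split; first by exists 0; rewrite mul0r.
  move=> r _ _ [x ->] [y ->]; exists (alg_map r * x + y).
  by rewrite mulrDl; congr (_ + _); rewrite [LHS]mulrA.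
- by [].
- by move=> n _ [x ->]; exists (x * a); rewrite exprS mulrA.
exists n => m nm; apply: (nP m (a ^+ n) nm); by exists 1; rewrite mul1r.
Qed.

(** For b = a^(m+1) with m large, the chains of right and left multiples give b = b b x = y b b.
    Then b x = y b, and this element is the idempotent. A positive exponent is imposed so that
    iterating a lift of an idempotent still lifts it. *)
Lemma dcc_fitting (C : pzAlgType R) (a : C) : dcc (base_mod C) ->
  exists m e x, [/\ e * e = e, a ^+ m.+1 * e = a ^+ m.+1 & e = a ^+ m.+1 * x].
Proof.
move=> CD; have [n nP] := dcc_power_stable a CD.
have [l lP] := dcc_power_stable_l a CD.
pose m := maxn n l; pose b := a ^+ m.+1.
have [x bx] : exists x, b = b * b * x.
  have nm : (n <= m.+1)%N by rewrite leqW // leq_maxl.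
  have [x xE] := nP (n + m.+1)%N (leq_addr _ _); exists x.
  by rewrite {1}/b -{1}(subnK nm) exprD xE mulrA -exprD addnA subnK // exprD.
have [y yb] : exists y, b = y * (b * b).
  have lm : (l <= m.+1)%N by rewrite leqW // leq_maxr.
  have [y yE] := lP (l + m.+1)%N (leq_addr _ _); exists y.
  by rewrite {1}/b -{1}(subnKC lm) exprD yE -mulrA -exprD addnAC subnKC // exprD.
have yx : b * x = y * b by rewrite {1}yb -mulrA -bx.
exists m, (b * x), x; split=> //; last by rewrite mulrA -bx.
by rewrite {1}yx mulrA -[y * b * b]mulrA -yb.
Qed.

Lemma linear_fitting (A : pzAlgType R) (M : lmodType A) (f : {linear M -> M}) :
  artin_algebra A -> fin_gen M ->
  exists m (e x : {linear M -> M}), forall v,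
    [/\ e (e v) = e v, iter m.+1 f (e v) = iter m.+1 f v &
        e v = iter m.+1 f (x v)].
Proof.
move=> Aart Mg.
(* The endomorphism algebra of M is realised on a complex concentrated in degree 0, so that
   [cend_dcc] provides the chain condition. *)
pose X := stalk_cx M 0.
have XD : dcc (base_mod (cend X)).
  by apply: cend_dcc => // [|i]; [exact: stalk_bounded|exact: stalk_fin_gen].
pose c i : {linear X i -> X i} :=
  cut_in (i == 0) M \o (f \o cut_val (i == 0) M).
have cC i j x : c j (diff X i j x) = diff X i j (c i x).
  by rewrite !stalk_diff0 linear0.
pose g : cend X := ChainMap cC.
pose ev (h : cend X) : {linear M -> M} := cut_val true M \o (h 0 \o cut_in true M).
have evM h k v : ev (h * k) v = ev h (ev k v).
  rewrite -[RHS]/(cut_val true M (h 0 (cut_in true M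
      (cut_val true M (k 0 (cut_in true M v)))))).
  by rewrite cut_inK.
have evg n v : ev (g ^+ n) v = iter n f v.
  by elim: n v => [|n IH] v; rewrite ?exprS ?evM ?IH.
have [m [e [x [ee ge ex]]]] := dcc_fitting g XD.
exists m, (ev e), (ev x) => v.
by rewrite -!evg -!evM ee ge -ex.
Qed.

Lemma lift_projective (A : pzAlgType R) (I : twoSidedIdeal A)
    (Q : lmodType (quot_alg I)) :
  artin_algebra A -> fin_gen Q -> projective Q ->
  exists2 P : lmodType A, fin_gen P /\ projective P &
    exists f : {linear bar_mod I P -> Q}, bijective f.
Proof.
move=> Aart [n [g gP]] Qproj.
pose F : lmodType A := {ffun 'I_n -> A^o}.
have Fg : fin_gen F := free_fin_gen A n.
pose p : {linear F -> res_mod (alg_projm I) Q} :=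
  ffun_gen (g : 'I_n -> res_mod (alg_projm I) Q).
have ps y : exists x, p x = y.
  have [c ->] := gP y; have [b bP] := choice (fun i => alg_proj_surj (c i)).
  exists [ffun i => b i : A^o]; apply: eq_bigr => i _.
  by rewrite ffunE res_barE bP.
have [pb pbP] : exists pb : {linear bar_mod I F -> Q},
    forall x, pb (bar_proj I x) = p x.
  have idl : linear (id : F -> F) by [].
  exact: (transfer_up p (@bar_projl_surj _ _ I F) (@bar_projl_ker _ _ I F)
    (mk_lin idl)).
have pbs y : exists x, pb x = y.
  by have [x <-] := ps y; exists (bar_proj I x).
have [s sP] : exists s : {linear Q -> bar_mod I F}, forall y, pb (s y) = y.
  have idl : linear (id : Q -> Q) by [].
  exact: (Qproj _ _ pb (mk_lin idl) pbs).
have [f fP] := transfer_down (bar_projl I F)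
  (s \o pb) (quot_barl_bij I F).
have [phi phiP] : exists phi : {linear F -> F}, forall x,
    bar_proj I (phi x) = s (pb (bar_proj I x)).
  (* The idempotent s pb of F/IF lifts to an endomorphism phi of the free module F, in general not
     idempotent. *)
  have [|phi phiP] := @free_projective A n _ _
    (@qmod_proj R A I F : {linear F -> quot_mod I F}) f.
    by elim/qmod_ind=> x; exists x.
  by exists phi => x; rewrite -[RHS]fP -[RHS]phiP.
have iterP m x : bar_proj I (iter m.+1 phi x) = s (pb (bar_proj I x)).
  by elim: m => [|m IH]; rewrite iterS phiP // IH sP.
have [m [e [x eP]]] := linear_fitting phi Aart Fg.
have ee v : e (e v) = e v by have [] := eP v.
(* Let eps = s pb, the reduction of every positive power of phi. From phi^(m+1) e = phi^(m+1) the
   reduction of eps e is eps, and from e = phi^(m+1) x it is that of e; so e reduces to eps. *)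
have barE v : bar_proj I (e v) = s (pb (bar_proj I v)).
  have [_ iter_e ex] := eP v.
  by rewrite -[RHS](iterP m) -iter_e iterP ex iterP sP.
exists (fixmod e).
  split; first exact: (fixmod_fin_gen ee Fg).
  exact: (fixmod_projective ee (@free_projective A n)).
exists (pb \o bar_map (fix_val e)); exists (fun y => bar_map (fix_in ee) (s y)).
  elim/bar_ind=> v; rewrite [X in s X]/= bar_mapE -barE bar_mapE.
  by rewrite fix_valP fix_inK.
move=> y; have [w wE] := bar_projl_surj (s y).
by rewrite -wE /= !bar_mapE fix_valK barE sP -[bar_proj I w]/(bar_projl I F w) wE sP.
Qed.

End Fitting.

(** * Generation and the natural map *)

Section Generation.
Variables (R : comPzRingType) (A : pzAlgType R) (I : twoSidedIdeal A).
Hypothesis Aart : artin_algebra A.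

Lemma lift_stalk (X : cochain (quot_alg I)) k :
  perfect X -> (forall i, i != k -> forall x : X i, x = 0) ->
  exists2 L : cochain A, perfect L & Kiso (bar_cx I L) X.
Proof.
move=> [_ Xp] X0; have [Xkg Xkp] := Xp k.
have [M [Mg Mp] [f [g fK gK]]] := lift_projective Aart Xkg Xkp.
exists (stalk_cx M k); first exact: perfect_stalk.
have dX0 i j (x : X i) : diff X i j x = 0.
  have [ij|ij] := eqVneq j (i + 1); last exact: diff_shape.
  have [ik|ik] := eqVneq i k; last by rewrite (X0 i ik x) linear0.
  by apply: X0; lia.
pose F i : {linear bar_cx I (stalk_cx M k) i -> X i} :=
  mk_lin (@deg_id_linear _ X k i) \o (f \o bar_map (cut_val (i == k) M)).
have FE i y : F i y = deg_id i (f (bar_map (cut_val (i == k) M) y)) by [].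
have FC i j x : F j (diff (bar_cx I (stalk_cx M k)) i j x) =
                diff X i j (F i x).
  rewrite dX0; elim/bar_ind: x => x.
  rewrite -[diff _ _ _ _]/(bar_map _ _) bar_mapE stalk_diff0.
  by rewrite -[bar_proj _ _]/(bar_projl _ _ 0) !linear0.
pose Fc := @ChainMap _ (bar_cx I (stalk_cx M k)) X F FC.
apply: (@Kiso_bij _ _ _ Fc) => i.
exists (fun y => bar_map (cut_in (i == k) M) (g (deg_id k y))).
  elim/bar_ind=> v; rewrite -[Fc i _]/(F i _) FE.
  have [/eqP ki|ki] := orP (orbN (i == k)).
    by rewrite (deg_idK (esym ki)) fK !bar_mapE cut_inK.
  rewrite (_ : v = 0); last by apply: cut_val_inj; rewrite linear0 cut_val0.
  by rewrite -[bar_proj _ _]/(bar_projl _ _ 0) !linear0 -(linear0 f) fK linear0.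
move=> y; rewrite -[Fc i _]/(F i _) FE.
have [/eqP ik|ik] := orP (orbN (i == k)); last by rewrite [RHS]X0 // [LHS]X0.
have cutK (w : bar_mod I M) :
    bar_map (cut_val (i == k) M) (bar_map (cut_in (i == k) M) w) = w.
  by elim/bar_ind: w => w; rewrite !bar_mapE cut_valK ifT // ik.
by rewrite cutK gK (deg_idK ik).
Qed.

Lemma bar_generates (T : cochain A) :
  generates (in_add T) -> generates (in_add (bar_cx I T)).
Proof.
move=> gT P Ptri TP; apply: (generated_by_stalks Ptri) => X k Xp X0.
have [L Lp LX] := lift_stalk Xp X0.
exact: (tri_iso Ptri (generates_bar Ptri gT TP Lp) Xp LX).
Qed.

End Generation.

(** * The natural map from B/J_I to the endomorphism algebra of T/IT *)

Lemma quot_alg_lift (R : pzRingType) (B C : pzAlgType R) (J : twoSidedIdeal B)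
    (g : {rmorphism B -> C}) :
  (forall r, g (alg_map r) = alg_map r) -> (forall b, b \in J -> g b = 0) ->
  exists h : {rmorphism quot_alg J -> C},
    (forall b, h (alg_proj J b) = g b) /\
    (forall r : R, h (alg_map r) = alg_map r).
Proof.
move=> gR gJ; pose h (x : quot_alg J) := g (repr x).
have hE b : h (alg_proj J b) = g b.
  by apply/subr0_eq; rewrite -rmorphB; apply: gJ; exact: quot_alg_repr.
have hz : zmod_morphism h.
  elim/quot_ind=> x; elim/quot_ind=> y.
  by rewrite -(rmorphB (alg_projm J)) !hE rmorphB.
have hm : monoid_morphism h.
  split; first by rewrite -(rmorph1 (alg_projm J)) hE rmorph1.
  elim/quot_ind=> x; elim/quot_ind=> y.
  by rewrite -(rmorphM (alg_projm J)) !hE rmorphM.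
pose hr : {rmorphism quot_alg J -> C} := HB.pack h
  (GRing.isZmodMorphism.Build _ _ h hz) (GRing.isMonoidMorphism.Build _ _ h hm).
exists hr.
by split=> // r; rewrite -gR -hE.
Qed.

Section NaturalMap.
Variables (R : pzRingType) (A : pzAlgType R) (I : twoSidedIdeal A).
Variable T : cochain A.

Definition bar_cend (f : cend T) : cend (bar_cx I T) := bar_cm I f.
Fact bar_cend_zmod : zmod_morphism bar_cend.
Proof.
move=> f g; apply: chain_map_ext => i; elim/bar_ind=> x.
by rewrite cm_subE /= !bar_mapE -[LHS]/(bar_projl _ _ _) linearB.
Qed.
Fact bar_cend_monoid : monoid_morphism bar_cend.
Proof.
by split=> [|f g]; apply: chain_map_ext => i; elim/bar_ind=> x; rewrite /= !bar_mapE.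
Qed.
HB.instance Definition _ := GRing.isZmodMorphism.Build (cend T)
  (cend (bar_cx I T)) bar_cend bar_cend_zmod.
HB.instance Definition _ := GRing.isMonoidMorphism.Build (cend T)
  (cend (bar_cx I T)) bar_cend bar_cend_monoid.
Definition bar_cendm : {rmorphism cend T -> cend (bar_cx I T)} := bar_cend.

Lemma bar_cend_map (r : R) : bar_cendm (alg_map r) = alg_map r.
Proof.
apply: chain_map_ext => i; elim/bar_ind=> x; rewrite /= bar_mapE /= /base_act.
by rewrite -[LHS]/(bar_projl I _ _) linearZZ.
Qed.

(** For g = 0 this identifies J_I with the kernel of the natural map; for general g it turns hitting
    an endomorphism of T/IT into lifting a map T -> T/IT up to homotopy. *)
Lemma bar_cm_proj_null (f : chain_map T T) (g : chain_map T (quot_cx I T))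
    (gb : chain_map (bar_cx I T) (bar_cx I T)) :
  (forall i x, gb i (bar_proj I x) = g i x) ->
  null_homotopic (cm_comp (cx_proj I T) f - g) <-> null_homotopic (bar_cm I f - gb).
Proof.
move=> gbP.
apply: (@transfer_null _ _ _ _ _ _ _ (bar_cx_proj I T) (quot_bar_cx I T)).
- by move=> i; exact: bar_projl_surj.
- by move=> i; exact: bar_projl_ker.
- by move=> i; exact: quot_barl_bij.
- by move=> i x; rewrite !cm_subE linearB; congr (_ - _); rewrite /= ?bar_mapE ?gbP.
Qed.

Lemma natural_map :
  exists h : {rmorphism quot_alg (J_ideal I T) -> KEnd (bar_cx I T)},
    [/\ forall r : R, h (alg_map r) = alg_map r,
        forall f : cend T, h (alg_proj _ (alg_proj _ f)) = alg_proj _ (bar_cendm f) &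
        injective h].
Proof.
pose g1 : {rmorphism cend T -> KEnd (bar_cx I T)} :=
  alg_projm (cend_null (bar_cx I T)) \o bar_cendm.
have [||h1 [h1E h1R]] := @quot_alg_lift R _ _ (cend_null T) g1.
- by move=> r; rewrite /g1 /= bar_cend_map.
- by move=> f /null_htpP /(bar_cm_null I) /null_htpP fn; apply/alg_proj_eq0.
have h1J (f : cend T) :
    h1 (alg_proj (cend_null T) f) = 0 <-> alg_proj (cend_null T) f \in J_ideal I T.
  have /bar_cm_proj_null : forall i x,
      (0 : chain_map (bar_cx I T) (bar_cx I T)) i (bar_proj I x) =
      (0 : chain_map T (quot_cx I T)) i x by [].
  move=> /(_ f); rewrite !subr0 => E.
  rewrite h1E J_idealE -[g1 f]/(alg_proj _ (bar_cendm f)) alg_proj_eq0.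
  by split=> /null_htpP fn; apply/null_htpP; apply/E.
have [||h [hE hR]] := @quot_alg_lift R _ _ (J_ideal I T) h1.
- exact: h1R.
- by elim/quot_ind=> f fJ; apply/h1J.
exists h; split=> // [f|x y]; first by rewrite hE h1E.
move/eqP; rewrite -subr_eq0 -rmorphB => /eqP hxy; apply/subr0_eq.
move: (x - y) hxy; elim/quot_ind; elim/quot_ind=> f.
by rewrite hE => /h1J fJ; apply/alg_proj_eq0.
Qed.

End NaturalMap.

(** * Shifted chain maps, the exact sequence of IT, and the equivalence *)

Section ShiftMap.
Variables (A : pzRingType) (n : int) (X Y : cochain A) (f : chain_map X Y).

Fact shift_cm_subproof i j x : f (j + n) (diff (shift n X) i j x) =
  diff (shift n Y) i j (f (i + n) x).
Proof.
rewrite -[diff (shift n X) i j x]/(shift_diff _ _).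
rewrite -[RHS]/(shift_diff _ _) /shift_diff.
by case: (odd _); rewrite ?linearN /= cmapP.
Qed.
Definition shift_cm : chain_map (shift n X) (shift n Y) :=
  @ChainMap A (shift n X) (shift n Y) (fun i => f (i + n)) shift_cm_subproof.

End ShiftMap.

Section IdealSequence.
Variables (R : pzRingType) (A : pzAlgType R) (I : twoSidedIdeal A).
Variable T : cochain A.

Fact ideal_incl_linear (M : lmodType A) :
  linear (@submod_val R A I M : ideal_submod I M -> M).
Proof. by []. Qed.
Definition ideal_incl : chain_map (ideal_cx I T) T :=
  @ChainMap A (ideal_cx I T) T (fun i => mk_lin (@ideal_incl_linear (T i)))
    (fun _ _ _ => erefl).

Lemma ideal_incl_inj i x : ideal_incl i x = 0 -> x = 0.
Proof. by move=> x0; exact: val_inj. Qed.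

Lemma cx_proj_incl i x : cx_proj I T i (ideal_incl i x) = 0.
Proof. by apply/qmod_proj_eq0; case: x. Qed.

Lemma cx_proj_ker i y : cx_proj I T i y = 0 -> exists x, ideal_incl i x = y.
Proof. by move/qmod_proj_eq0 => yI; exists (IdealSubmod yI). Qed.

Lemma cx_proj_surj i z : exists y, cx_proj I T i y = z.
Proof. by elim/qmod_ind: z => x; exists x. Qed.

End IdealSequence.

Theorem theorem4p2 (R : comPzRingType) (A : pzAlgType R)
    (hA : artin_algebra A) (T : cochain A) (hT : tilting T)
    (I : twoSidedIdeal A) :
  (tilting (bar_cx I T) /\
   alg_iso (quot_alg (J_ideal I T)) (KEnd (bar_cx I T))) <->
  ((forall i : int, i != 0 -> Hom_zero T (shift i (ideal_cx I T))) /\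
   Hom_zero (quot_cx I T) (shift (-1) (quot_cx I T))).
Proof.
have [Tperf Thom Tgen] := hT; have [Tbd Tfp] := Tperf.
have Tproj i : projective (T i) := (Tfp i).2.
have [h [hR hE h_inj]] := natural_map I T.
split=> [[[bar_perf bar_hom _] [psi [psiR [q psiK qK]]]]|[IT_hom bar_hom]].
  split; last by apply/Hom_zero_quot_bar_shift; exact: bar_hom.
  have KD : dcc (base_mod (KEnd (bar_cx I T))).
    apply: KEnd_dcc; first exact: quot_artin_algebra.
      by case: bar_perf.
    by move=> i; case: bar_perf => _ /(_ i)[].
  (* q inverts the given isomorphism psi, from which it inherits R-linearity. *)
  have hql : linear ((fun y => h (q y)) :
      base_mod (KEnd (bar_cx I T)) -> base_mod (KEnd (bar_cx I T))).
    move=> r x y; rewrite -{1}(qK x) -{1}(qK y).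
    rewrite -[_ *: _]/(alg_map r * psi (q x)) -psiR -rmorphM -rmorphD psiK.
    by rewrite rmorphD rmorphM hR.
  have h_surj y : exists x, h x = y.
    have hq_inj : injective (mk_lin hql) by apply: inj_comp h_inj (can_inj qK).
    by have [x <-] := dcc_inj_surj KD hq_inj y; exists (q x).
  have lift (f : chain_map T (quot_cx I T)) : exists g : chain_map T T,
      null_homotopic (cm_comp (cx_proj I T) g - f).
    have [fb fbP] := transfer_cm_up (p := bar_cx_proj I T) (quot_bar_cx I T)
      (fun i => @bar_projl_surj _ _ I (T i)) (fun i => @bar_projl_ker _ _ I (T i)) f.
    have [x] := h_surj (alg_proj (cend_null (bar_cx I T)) fb).
    elim/quot_ind: x; elim/quot_ind=> g; rewrite hE => /Kcls_eq/null_htpP gE.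
    by exists g; apply: (@bar_cm_proj_null _ _ I T g f fb fbP).2; exact: gE.
  (* For i = 1 the preceding term of the sequence is Hom(T, T/IT), in general nonzero; here the
     lifting property is used. *)
  move=> i i0; have [->|i1] := eqVneq i 1.
    apply: (Hom_zero_sub Tproj (@ideal_incl_inj _ _ I T) (@cx_proj_incl _ _ I T)
      (@cx_proj_ker _ _ I T) (@cx_proj_surj _ _ I T) lift).
    exact: Thom.
  rewrite -(subrK 1 i); apply/Hom_zero_shift1.
  apply: (Hom_zero_sub (u := shift_cm (i - 1) (ideal_incl I T))
    (v := shift_cm (i - 1) (cx_proj I T)) Tproj).
  - by move=> j; exact: ideal_incl_inj.
  - by move=> j; exact: cx_proj_incl.
  - by move=> j; exact: cx_proj_ker.
  - by move=> j; exact: cx_proj_surj.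
  (* Since i - 1 <> 0, every map T -> T/IT[i-1] is null homotopic, so zero lifts it. *)
  - move=> f; exists 0; apply: null_homotopicB.
      exact/null_homotopic_compl/null_homotopic0.
    have /Hom_zeroP : Hom_zero T (shift (i - 1) (quot_cx I T)).
      by apply/Hom_zero_bar_shift/bar_hom; rewrite subr_eq0.
    exact.
  - by apply/Hom_zero_shift1; rewrite subrK; exact: Thom.
split.
  split; [exact: bar_perfect | | exact: bar_generates].
  (* In degree -1 the next term would be Hom(T, IT), about which nothing is assumed; the second
     condition takes over. *)
  move=> n n0; have [->|n1] := eqVneq n (-1).
    exact/Hom_zero_quot_bar_shift.
  apply/Hom_zero_bar_shift.
  apply: (Hom_zero_quotient (u := shift_cm n (ideal_incl I T))
    (v := shift_cm n (cx_proj I T)) Tproj).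
  - by move=> j; exact: ideal_incl_inj.
  - by move=> j; exact: cx_proj_incl.
  - by move=> j; exact: cx_proj_ker.
  - by move=> j; exact: cx_proj_surj.
  - by apply/Hom_zero_shift1/IT_hom; rewrite addr_eq0.
  - exact: Thom.
exists h; split=> //.
(* Hom(T, IT[1]) = 0 lifts a chain map T -> T/IT exactly, so the preimage is obtained without
   correcting by a homotopy. *)
have h_surj y : exists x, h x = y.
  elim/quot_ind: y => gb.
  have [f fP] := transfer_cm_down (bar_cx_proj I T) (phi := quot_bar_cx I T)
    (fun i => quot_barl_bij I (T i)) gb.
  have [g gP] := lift_chain_map Tproj (@ideal_incl_inj _ _ I T)
    (@cx_proj_incl _ _ I T) (@cx_proj_ker _ _ I T) (@cx_proj_surj _ _ I T) f
    (IT_hom 1 isT).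
  exists (alg_proj _ (alg_proj _ (g : cend T))); rewrite hE; congr (alg_proj _ _).
  apply: chain_map_ext => i; elim/bar_ind=> x.
  by rewrite [LHS]bar_mapE [RHS]fP -[f i x]gP.
have [k kP] := choice h_surj.
by exists k => // x; apply: h_inj; exact: kP.
Qed.
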